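(* Let $n\geq 1$ be an integer and let $m\in\mathbb{Z}$. Then, as $b\to+\infty$ (with $n,m$ fixed), $$\lambda_n\left(H^N_{m,b}\right) = \left(2n-1+|m|-m\right) b - e^{-\frac b2}\left(\frac{b^{2n+|m|}}{(n-1)!\,(|m|+n-1)!\,2^{2(n-1)+|m|}} + \mathcal{O}\left(b^{2n+|m|-1}\right)\right).$$
   Context: For $b>0$ and $m\in\mathbb{Z}$ consider the differential expression on $(0,1)$ $$H_{m,b} = -\frac{d^2}{dr^2}-\frac1r\frac{d}{dr}+\left(\frac mr-\frac{br}{2}\right)^2 ,$$ acting in the Hilbert space $L^2((0,1),r\,dr)$. Its Neumann realization $H^N_{m,b}$ is the self-adjoint operator with domain, for $m\neq 0$, $$\{u : u,\ u/r,\ u',\ H_{m,b}u\in L^2((0,1),r\,dr),\ u'(1)=0\},$$ and, for $m=0$, $$\{u : u,\ H_{0,b}u\in L^2((0,1),r\,dr),\ u'(1)=0,\ \lim_{r\to0^+} u(r)/\ln r=0\}.$$ It has discrete spectrum, and $\lambda_n(H^N_{m,b})$ denotes its $n$-th eigenvalue ($n\ge1$) in increasing order, counting multiplicity. (These are the eigenvalue branches of the Neumann magnetic Laplacian $(-i\nabla+bA)^2$, $A(x_1,x_2)=\frac12(-x_2,x_1)$, on the unit disc, restricted to the angular mode $e^{-im\theta}$.) The notation $\mathcal{O}(b^{p})$ stands for a quantity bounded in absolute value by $Kb^{p}$ for all $b\ge b_0$, with constants $K,b_0>0$ that may depend on $n$ and $m$ but not on $b$. *)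

(* Defs.v *)
From HB Require Import structures.
From mathcomp Require Import all_boot all_order all_algebra.
From mathcomp Require Import all_classical all_reals all_analysis.
From mathcomp Require Import complex.
Import Order.TTheory GRing.Theory Num.Theory.
Import numFieldNormedType.Exports.

Set Implicit Arguments.
Unset Strict Implicit.
Unset Printing Implicit Defensive.

Local Open Scope classical_set_scope.
Local Open Scope complex_scope.
Local Open Scope ring_scope.

Section NeumannFiber.
Variable R : realType.

Local Notation mu := (@lebesgue_measure R).
Local Notation C := (R[i]).
Local Notation I01 := (`]0, 1[%classic : set R).

Implicit Types (u v : R -> C) (m : int) (b x : R).

(* Elements of L^2((0,1), r dr) are represented by functions R -> C, of which
   only the restriction to (0,1) matters; equality is almost everywhere. *)
Definition L2 u : Prop :=
  [/\ measurable_fun I01 (fun r => complex.Re (u r)),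
      measurable_fun I01 (fun r => complex.Im (u r)) &
      mu.-integrable I01 (fun r => (Normc.normc (u r) ^+ 2 * r)%:E)].

Definition eqL2 u v : Prop :=
  {ae mu, forall r, I01 r -> u r = v r}.

Definition cderiv u : R -> C :=
  fun r => derive1 (fun t => complex.Re (u t)) r
           +i* derive1 (fun t => complex.Im (u t)) r.

(* Local absolute continuity on (0,1).  [derive1] is total (it is 0 at points
   of non-differentiability), so this says exactly that f' is locally
   integrable on (0,1) and is the weak derivative of f. *)
Definition AC_loc (f : R -> R) : Prop :=
  forall s t : R, 0 < s -> s <= t -> t < 1 ->
    mu.-integrable `[s, t] (EFin \o derive1 f) /\
    f t - f s = \int[mu]_(r in `[s, t]) derive1 f r.

Definition cAC_loc u : Prop :=
  AC_loc (fun r => complex.Re (u r)) /\ AC_loc (fun r => complex.Im (u r)).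

Definition opH m b u : R -> C := fun r =>
  - cderiv (cderiv u) r - (r^-1)%:C * cderiv u r
  + ((m%:~R / r - b * r / 2) ^+ 2)%:C * u r.

(* Requiring u and u' to be locally absolutely continuous selects the
   continuously differentiable representative of a function u in L^2 whose
   distributional H_{m,b} u is in L^2; u'(1) is then the limit of u' at 1. *)
Definition domN m b u : Prop :=
  [/\ cAC_loc u /\ cAC_loc (cderiv u),
      L2 u,
      L2 (opH m b u),
      Normc.normc (cderiv u r) @[r --> (1 : R)^'-] --> (0 : R) &
      if m != 0 then L2 (fun r => u r / r%:C) /\ L2 (cderiv u)
      else Normc.normc (u r / (ln r)%:C) @[r --> (0 : R)^'+] --> (0 : R)].

Definition eigenspace m b x u : Prop :=
  domN m b u /\ eqL2 (opH m b u) (fun r => x%:C * u r).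

(* The eigenspace of x has complex dimension d, i.e. a basis of d vectors;
   d = 0 means that x is not an eigenvalue. *)
Definition multiplicity m b x (d : nat) : Prop :=
  exists e : 'I_d -> (R -> C),
    (forall i, eigenspace m b x (e i)) /\
    (forall u, eigenspace m b x u ->
       exists! c : 'rV[C]_d, eqL2 u (fun r => \sum_(i < d) c 0 i * e i r)).

(* s lists the first n eigenvalues, in nondecreasing order and repeated
   according to multiplicity.  The last one may occur in s fewer times than its
   multiplicity, since the list is cut after n terms. *)
Definition first_eigenvalues m b (n : nat) (s : seq R) : Prop :=
  [/\ size s = n,
      sorted <=%R s,
      forall x, x < last 0 s -> multiplicity m b x (count_mem x s) &
      exists2 d, multiplicity m b (last 0 s) d &
                 (count_mem (last 0%R s) s <= d)%N].

(* Well defined for n >= 1; the default value is 0. *)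
Definition lambdaN m b (n : nat) : R :=
  xget 0 [set x | exists2 s, first_eigenvalues m b n s & last 0 s = x].

End NeumannFiber.

(* Main.v *)
(** In the variable s = b r^2 / 2, with k = |m|, the solution of H_{m,b} u = x u
    that is regular at 0 is r^k e^{-s/2} M(a, k + 1, s), where M is Kummer's
    function and a = 1/2 + (k - m)/2 - x/(2 b).  A Wronskian argument at 0 shows
    that the elements of the domain solving the equation are its multiples, so
    all eigenvalues are simple, and the Neumann condition becomes
    G(a, z) := (k - z) M(a, k + 1, z) + 2 z M'(a, k + 1, z) = 0 with z = b / 2.

    For a = x - p with p a natural number, every coefficient of the power
    series of G of index > p + 1 has the factor x, hence
    G(x - p, z) = A(x, z) + (-1)^p x z^{p+2} T(x, z) with A a polynomial of degree
    p + 1 in z and T of size e^z z^{-2p-k-2}.  So for large z there is exactly one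
    root with x in [-1/2, 1/2]; it is exponentially small, and comparing the
    leading terms of A and T gives x ~ z^{2p+k+1} e^{-z} / (p! (k + p)!).  There
    are no roots with a >= 1, so p = 0, 1, 2, ... enumerates all eigenvalues in
    increasing order. *)
Require Import Defs.
From HB Require Import structures.
From mathcomp Require Import all_boot all_order all_algebra.
From mathcomp Require Import all_classical all_reals all_analysis.
From mathcomp Require Import complex ring lra zify.
Import Order.TTheory GRing.Theory Num.Theory.
Import numFieldNormedType.Exports.
Set Implicit Arguments.
Unset Strict Implicit.
Local Open Scope classical_set_scope.
Local Open Scope ring_scope.

(** * Power series dominated by an exponential series *)

Section EntireSeries.
Variable R : realType.
Implicit Types (w : nat -> R) (z : R).

(** The obstacle is uniformity in x: asymptotics of A and T at x = 0 say nothing about roots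
    elsewhere in the range. Lipschitz bounds in x, with constants explicit in z, take the place of
    derivatives in the parameter. A lower bound on T that is uniform in x, although it loses powers
    of z, already forces every root to be exponentially small. Replacing x by 0 in A and T then
    produces errors with an extra factor |x|, which beats every power of z, so precise asymptotics
    are needed at x = 0 only. *)

Definition entire_coef w :=
  exists C D : R, forall j, `|w j| <= C * D ^+ j / j`!%:R.

Definition psum w z : R := limn (pseries w z).

Lemma entire_cvg w z : entire_coef w -> cvgn (pseries w z).
Proof.
move=> [C [D wle]]; apply: normed_cvg.
apply: (@series_le_cvg _ _ (fun n => `|C| * exp_coeff (`|D| * `|z|) n)) => [n|n|n|].
- exact: normr_ge0.
- by rewrite mulr_ge0// /exp_coeff/= divr_ge0// exprn_ge0// mulr_ge0.
- rewrite /= normrM normrX /exp_coeff/= exprMn.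
  rewrite [leRHS](_ : _ = (`|C| * `|D| ^+ n / n`!%:R) * `|z| ^+ n); last by ring.
  rewrite ler_wpM2r ?exprn_ge0//; apply: le_trans (wle n) _.
  rewrite ler_wpM2r ?invr_ge0//.
  by rewrite (le_trans (ler_norm _))// normrM normrX.
- exact: is_cvg_seriesZ (is_cvg_series_exp_coeff _).
Qed.

Lemma entire_diffs w : entire_coef w -> entire_coef (pseries_diffs w).
Proof.
move=> [C [D wle]]; exists (C * D), D => j; rewrite /pseries_diffs normrM normr_nat.
rewrite (le_trans (ler_wpM2l _ (wle _)))// factS natrM exprS invfM.
rewrite [leLHS](_ : _ = (j.+1%:R / j.+1%:R) * (C * D * D ^+ j / j`!%:R)).
  by rewrite divff ?mul1r.
by ring.
Qed.

Lemma is_derive_psum w z : entire_coef w ->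
  is_derive z (1 : R) (psum w) (psum (pseries_diffs w) z).
Proof.
move=> we; apply: (@pseries_snd_diffs _ _ (`|z| + 1)).
- exact: entire_cvg.
- exact/entire_cvg/entire_diffs.
- exact/entire_cvg/entire_diffs/entire_diffs.
- by rewrite [ltRHS]ger0_norm ?addr_ge0// ltrDl.
Qed.

Lemma psum_cvg w z : entire_coef w -> pseries w z @ \oo --> psum w z.
Proof. by move=> we; exact: entire_cvg. Qed.

Lemma entireD w1 w2 : entire_coef w1 -> entire_coef w2 ->
  entire_coef (fun j => w1 j + w2 j).
Proof.
move=> [C1 [D1 w1le]] [C2 [D2 w2le]].
exists (`|C1| + `|C2|), (`|D1| + `|D2|) => j.
rewrite (le_trans (ler_normD _ _))// mulrDl mulrDl lerD//.
  rewrite (le_trans (w1le j))// ler_wpM2r ?invr_ge0//.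
  rewrite (le_trans (ler_norm _))// normrM normrX ler_wpM2l// lerXn2r ?nnegrE ?addr_ge0//.
  by rewrite lerDl.
rewrite (le_trans (w2le j))// ler_wpM2r ?invr_ge0//.
rewrite (le_trans (ler_norm _))// normrM normrX ler_wpM2l// lerXn2r ?nnegrE ?addr_ge0//.
by rewrite lerDr.
Qed.

Lemma entireZ w (c : R) : entire_coef w -> entire_coef (fun j => c * w j).
Proof.
move=> [C [D wle]]; exists (`|c| * C), D => j.
by rewrite normrM -!mulrA ler_wpM2l// mulrA.
Qed.

Lemma psumD w1 w2 z : entire_coef w1 -> entire_coef w2 ->
  psum (fun j => w1 j + w2 j) z = psum w1 z + psum w2 z.
Proof.
move=> e1 e2; apply: cvg_lim => //.
rewrite (_ : pseries _ _ = fun n => pseries w1 z n + pseries w2 z n).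
  exact: cvgD (psum_cvg e1) (psum_cvg e2).
apply/funext => n; rewrite /pseries/= /series/= -big_split/=.
by apply: eq_bigr => i _; rewrite mulrDl.
Qed.

Lemma psumZ w (c : R) z : entire_coef w ->
  psum (fun j => c * w j) z = c * psum w z.
Proof.
move=> e1; apply: cvg_lim => //.
rewrite (_ : pseries _ _ = fun n => c * pseries w z n).
  by apply: cvgM (psum_cvg e1); exact: cvg_cst.
apply/funext => n; rewrite /pseries/= /series/= mulr_sumr.
by apply: eq_bigr => i _; rewrite mulrA.
Qed.

Lemma entire_le w1 w2 : entire_coef w2 -> (forall j, `|w1 j| <= `|w2 j|) ->
  entire_coef w1.
Proof.
by move=> [C [D wle]] h; exists C, D => j; exact: le_trans (h j) (wle j).
Qed.

(** Differentiation multiplies the shifted coefficient by j + 1 >= 1, so each shift by one is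
    dominated by a derivative. *)
Lemma entire_shift w n : entire_coef w -> entire_coef (fun j => w (j + n)%N).
Proof.
elim: n => [|n IH] we.
  by apply: (entire_le we) => j; rewrite addn0.
apply: (entire_le (entire_diffs (IH we))) => j.
rewrite /pseries_diffs normrM addSnnS ler_peMl// normr_nat ler1n//.
Qed.

Lemma psum_split w n z : entire_coef w ->
  psum w z = \sum_(0 <= j < n) w j * z ^+ j
             + z ^+ n * psum (fun j => w (j + n)%N) z.
Proof.
move=> we; apply: cvg_lim => //; rewrite -(cvg_shiftn n)/=.
rewrite (_ : (fun _ => _) = fun N => \sum_(0 <= j < n) w j * z ^+ j
  + z ^+ n * pseries (fun j => w (j + n)%N) z N).
  apply: cvgD; first exact: cvg_cst.
  by apply: cvgM; [exact: cvg_cst|exact/psum_cvg/entire_shift].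
apply/funext => N; rewrite /pseries/= /series/= (@big_cat_nat _ _ _ n)//= ?leq_addl//.
congr (_ + _); rewrite -{1}[n]add0n big_addn addnK mulr_sumr.
by apply: eq_bigr => i _; rewrite exprD; ring.
Qed.

Lemma ler_psum w1 w2 z : entire_coef w1 -> entire_coef w2 -> 0 <= z ->
  (forall j, w1 j <= w2 j) -> psum w1 z <= psum w2 z.
Proof.
move=> e1 e2 z0 h; apply: ler_lim; [exact: entire_cvg|exact: entire_cvg|].
near=> n; apply: ler_sum => i _; rewrite ler_wpM2r// exprn_ge0//.
Unshelve. all: by end_near. Qed.

Lemma psum_ge w z j : entire_coef w -> 0 <= z -> (forall j, 0 <= w j) ->
  w j * z ^+ j <= psum w z.
Proof.
move=> e1 z0 w0; rewrite (psum_split j.+1)// big_nat_recr//= addrAC -[leLHS]add0r lerD//.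
rewrite addr_ge0//.
  by rewrite sumr_ge0// => i _; rewrite mulr_ge0// exprn_ge0.
rewrite mulr_ge0 ?exprn_ge0//.
rewrite -(mul0r (psum w z)) -psumZ//; apply: ler_psum => //.
- exact: entireZ.
- exact: entire_shift.
- by move=> i; rewrite mul0r.
Qed.

(** The tail of the exponential series from degree q on, divided by z^q. Its sum behaves like e^z
    z^{-q}, which makes these series the scale against which all others are measured, coefficient by
    coefficient. *)
Definition fact_inv q (l : nat) : R := ((l + q)`!%:R)^-1.

Lemma entire_fact_inv q : entire_coef (fact_inv q).
Proof.
exists 1, 1 => j; rewrite expr1n !mul1r ger0_norm ?invr_ge0//.
rewrite lef_pV2 ?posrE ?ltr0n ?fact_gt0// ler_nat.
by rewrite leq_fact// leq_addr.
Qed.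

Lemma psum_fact_inv0 z : psum (fact_inv 0) z = expR z.
Proof.
by rewrite expRE /psum /fact_inv; under eq_fun do rewrite addn0.
Qed.

Lemma expR_fact_inv q z :
  expR z = \sum_(0 <= j < q) z ^+ j / j`!%:R + z ^+ q * psum (fact_inv q) z.
Proof.
rewrite -psum_fact_inv0 (psum_split q)//; last exact: entire_fact_inv.
congr (_ + _ * psum _ z).
  by apply: eq_bigr => i _; rewrite /fact_inv addn0 mulrC.
by apply/funext => j; rewrite /fact_inv addn0.
Qed.

Lemma fact_inv_le_expR q z : 0 <= z -> z ^+ q * psum (fact_inv q) z <= expR z.
Proof.
move=> z0; rewrite (expR_fact_inv q z) lerDr sumr_ge0// => i _.
by rewrite divr_ge0// exprn_ge0.
Qed.

Lemma pow_le_expR (C : R) n : \forall z \near +oo, C * z ^+ n <= expR z.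
Proof.
near=> z; have z0 : 0 <= z by near: z; exact: nbhs_pinfty_ge.
apply: le_trans (_ : z ^+ n.+1 / n.+1`!%:R <= _); last first.
  by rewrite (le_trans _ (expR_ge1Dxn n z0))// lerDr.
rewrite ler_pdivlMr ?ltr0n ?fact_gt0// mulrAC exprS.
by rewrite ler_wpM2r ?exprn_ge0//.
Unshelve. all: by end_near. Qed.

(** The difference is a polynomial of degree below q; after multiplication by z each of its q terms
    is at most z^q, hence eventually below e^z. *)
Lemma fact_inv_asympt q : exists C : R,
  \forall z \near +oo, z * `|z ^+ q * psum (fact_inv q) z - expR z| <= C * expR z.
Proof.
exists (\sum_(0 <= j < q) 1); near=> z.
have z1 : 1 <= z by near: z; exact: nbhs_pinfty_ge.
have z0 : 0 <= z by rewrite (le_trans _ z1).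
rewrite (expR_fact_inv q z) opprD addrCA subrr addr0 normrN -expR_fact_inv.
rewrite ger0_norm; last by rewrite sumr_ge0// => i _; rewrite divr_ge0// exprn_ge0.
rewrite mulr_sumr mulr_suml big_nat_cond [leRHS]big_nat_cond ler_sum// => i /andP[/= iq _].
rewrite mul1r mulrA -exprS; apply: (@le_trans _ _ (1 * z ^+ q.+1)).
  rewrite mul1r ler_pdivrMr ?ltr0n ?fact_gt0// (@le_trans _ _ (z ^+ q.+1))//.
    by rewrite ler_weXn2l// ltnW.
  by rewrite ler_peMr ?exprn_ge0// ler1n fact_gt0.
by near: z; exact: pow_le_expR.
Unshelve. all: by end_near. Qed.

(** Passing from q to q + 1 costs a factor z in the sum, so a relative error of order 1/l in the
    coefficients becomes a relative error of order 1/z in the sum. *)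
Lemma psum_asympt w q (c C : R) : entire_coef w ->
    (forall l, `|w l - c * fact_inv q l| <= C * fact_inv q.+1 l) ->
  exists K : R,
    \forall z \near +oo, z * `|z ^+ q * psum w z - c * expR z| <= K * expR z.
Proof.
move=> we wle; have [K KP] := fact_inv_asympt q.
exists (`|c| * K + C); near=> z.
have z1 : 1 <= z by near: z; exact: nbhs_pinfty_ge.
have z0 : 0 <= z by rewrite (le_trans _ z1).
have eq0 := entireZ c (entire_fact_inv q).
have eq1 := entireZ C (entire_fact_inv q.+1).
have le1 : `|psum w z - c * psum (fact_inv q) z| <= C * psum (fact_inv q.+1) z.
  rewrite -!psumZ; try exact: entire_fact_inv.
  rewrite ler_distl; apply/andP; split.
    rewrite -[X in _ - X]mul1r -mulN1r mul1r -psumZ// -psumD//; last exact: entireZ.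
    apply: ler_psum => // [|j]; first by apply: entireD => //; exact: entireZ.
    by have := wle j; rewrite ler_distl => /andP[? ?]; lra.
  rewrite -psumD//; apply: ler_psum => // [|j]; first exact: entireD.
  by have := wle j; rewrite ler_distl => /andP[? ?]; lra.
have -> : z ^+ q * psum w z - c * expR z =
   z ^+ q * (psum w z - c * psum (fact_inv q) z)
   + c * (z ^+ q * psum (fact_inv q) z - expR z) by ring.
apply: le_trans (ler_wpM2l z0 (ler_normD _ _)) _.
rewrite mulrDr addrC mulrDl lerD//.
  rewrite normrM mulrCA -mulrA ler_wpM2l//; near: z; exact: KP.
rewrite normrM ger0_norm ?exprn_ge0// mulrA -exprS.
apply: (@le_trans _ _ (z ^+ q.+1 * (C * psum (fact_inv q.+1) z))).
  by rewrite ler_wpM2l ?exprn_ge0.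
rewrite mulrCA ler_wpM2l ?fact_inv_le_expR//.
have := le_trans (normr_ge0 _) (wle 0%N).
by rewrite pmulr_lge0// /fact_inv invr_gt0 ltr0n fact_gt0.
Unshelve. all: by end_near. Qed.

Lemma psum_lower w q (c C : R) : entire_coef w -> 0 < c ->
    (forall l, c * fact_inv q l - C * fact_inv q.+1 l <= w l) ->
  \forall z \near +oo, c / 2 * expR z <= z ^+ q * psum w z.
Proof.
move=> we c0 wge.
pose w' l := c * fact_inv q l - C * fact_inv q.+1 l.
have w'e : entire_coef w'.
  apply: (@entire_le _ (fun l => c * fact_inv q l + (- C) * fact_inv q.+1 l)).
    by apply: entireD; apply: entireZ; exact: entire_fact_inv.
  by move=> j; rewrite mulNr.
have [|K KP] := @psum_asympt w' q c `|C| w'e.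
  move=> l; rewrite /w' addrAC subrr add0r normrN normrM.
  by rewrite ler_wpM2l// ger0_norm// invr_ge0.
near=> z.
have z1 : 1 <= z by near: z; exact: nbhs_pinfty_ge.
have z0 : 0 <= z by rewrite (le_trans _ z1).
apply: (@le_trans _ _ (z ^+ q * psum w' z)); last first.
  by rewrite ler_wpM2l ?exprn_ge0// ler_psum.
have : z * `|z ^+ q * psum w' z - c * expR z| <= K * expR z by near: z.
have : 2 * K / c <= z by near: z; apply: nbhs_pinfty_ge; exact: num_real.
rewrite ler_pdivrMr// => Kz h.
have h2 : `|z ^+ q * psum w' z - c * expR z| <= c / 2 * expR z.
  rewrite -(@ler_pM2l _ z) ?(lt_le_trans _ z1)// (le_trans h)//.
  by rewrite mulrA ler_wpM2r ?expR_ge0//; lra.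
by move: h2; rewrite ler_distl => /andP[]; lra.
Unshelve. all: by end_near. Qed.

End EntireSeries.

(** * Kummer's function and the Neumann function *)

Section Kummer.
Variable R : realType.
Implicit Types (w : nat -> R) (a x z : R) (k p j l : nat).

Lemma factr_neq0 n : n`!%:R != 0 :> R.
Proof. by rewrite (eqr_nat R _ 0) -lt0n fact_gt0. Qed.

Lemma nat1r_neq0 n : 1 + n%:R != 0 :> R.
Proof. by rewrite nat1r pnatr_eq0. Qed.

(** On coefficients, this is multiplication of the series by z. *)
Definition shiftr w : nat -> R := fun j => if j is i.+1 then w i else 0.

Lemma entire_shiftr w : entire_coef w -> entire_coef (shiftr w).
Proof.
(* The shift loses a factor j + 1, which the extra 2^{j+1} absorbs; adding 1 to |D| pays for the
   additional power. *)
move=> [C [D wle]]; exists `|C|, (2 * (`|D| + 1)) => -[|j]/=.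
  by rewrite normr0 expr0 mulr1 fact0 divr1.
apply: le_trans (wle j) _; rewrite factS natrM invfM.
rewrite ler_pdivrMr ?ltr0n ?fact_gt0//.
rewrite [leRHS](_ : _ = `|C| * ((2 * (`|D| + 1)) ^+ j.+1 / j.+1%:R)); last first.
  by rewrite -!mulrA mulVf ?mulr1// factr_neq0.
rewrite (le_trans (ler_norm _))// normrM normrX ler_wpM2l//.
rewrite ler_pdivlMr// mulrC exprMn; apply: ler_pM => //.
  by rewrite -natrX ler_nat ltnW// ltn_expl.
rewrite exprS (@le_trans _ _ ((`|D| + 1) ^+ j))//.
  by rewrite lerXn2r ?nnegrE ?addr_ge0// lerDl.
by rewrite ler_peMl ?exprn_ge0 ?addr_ge0// lerDr.
Qed.

Lemma psum_shiftr w z : entire_coef w -> psum (shiftr w) z = z * psum w z.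
Proof.
move=> we; rewrite (psum_split 1)//; last exact: entire_shiftr.
rewrite big_nat1 mul0r add0r expr1; congr (_ * psum _ _).
by apply/funext => j; rewrite addn1.
Qed.

Lemma psum_diffs w z : entire_coef w ->
  z * psum (pseries_diffs w) z = psum (fun j => j%:R * w j) z.
Proof.
move=> we; rewrite -psum_shiftr; last exact: entire_diffs.
by congr (psum _ _); apply/funext => -[|j]//=; rewrite mul0r.
Qed.

Definition poch a j : R := \prod_(i < j) (a + i%:R).

Lemma poch0 a : poch a 0 = 1. Proof. by rewrite /poch big_ord0. Qed.

Lemma pochS a j : poch a j.+1 = poch a j * (a + j%:R).
Proof. by rewrite /poch big_ord_recr. Qed.

Lemma pochD a i j : poch a (i + j) = poch a i * poch (a + i%:R) j.
Proof.
elim: j => [|j IH]; first by rewrite addn0 poch0 mulr1.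
by rewrite addnS !pochS IH natrD !mulrA addrA.
Qed.

Lemma pochN x p : poch (x - p%:R) p = (-1) ^+ p * poch (1 - x) p.
Proof.
elim: p => [|p IH]; first by rewrite !poch0 mulr1.
rewrite -[in LHS]add1n pochD pochS poch0 mul1r addr0 pochS exprS.
rewrite (_ : x - (1 + p)%:R + 1%:R = x - p%:R); last by rewrite natrD; ring.
by rewrite IH natrD; ring.
Qed.

(* Coefficients of Kummer's function M(a, k + 1, z). *)
Definition kummer_coef a k j : R :=
  k`!%:R * poch a j / ((k + j)`!%:R * j`!%:R).

Lemma kummer_coef0 a k : kummer_coef a k 0 = 1.
Proof. by rewrite /kummer_coef poch0 addn0 fact0 !mulr1 divff// factr_neq0. Qed.

Lemma kummer_coefS a k j :
  j.+1%:R * (k + j.+1)%:R * kummer_coef a k j.+1 = (a + j%:R) * kummer_coef a k j.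
Proof.
rewrite /kummer_coef pochS addnS !factS !natrM.
by field; rewrite !factr_neq0 -natrD !nat1r_neq0.
Qed.

Lemma entire_kummer_coef a k : entire_coef (kummer_coef a k).
Proof.
(* The constant comes from |a + j| <= (|a| + 1)(j + 1) in the recurrence for the coefficients. *)
exists 1, (`|a| + 1) => j; rewrite mul1r.
elim: j => [|j IH]; first by rewrite kummer_coef0 normr1 expr0 divr1.
have kj : 0 < j.+1%:R * (k + j.+1)%:R :> R by rewrite mulr_gt0// ltr0n addnS.
rewrite -(ler_pM2l kj) -{1}(gtr0_norm kj) -normrM kummer_coefS normrM.
apply: (@le_trans _ _ ((`|a| + 1) * j.+1%:R * ((`|a| + 1) ^+ j / j`!%:R))).
  apply: ler_pM => //; rewrite (le_trans (ler_normD _ _))// normr_nat.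
  rewrite -natr1 mulrDl mul1r mulrDr mulr1.
  have : 0 <= `|a| * j%:R by rewrite mulr_ge0.
  by have : 0 <= `|a| by []; lra.
rewrite factS natrM exprS.
rewrite [leRHS](_ : _ = (k + j.+1)%:R * ((`|a| + 1) * (`|a| + 1) ^+ j / j`!%:R)); last first.
  by field; rewrite ?factr_neq0 ?nat1r_neq0.
rewrite [leLHS](_ : _ = j.+1%:R * ((`|a| + 1) * (`|a| + 1) ^+ j / j`!%:R)); last by ring.
rewrite ler_wpM2r ?ler_nat ?leq_addl// divr_ge0// -exprS exprn_ge0.
Qed.

Definition kummer a k z := psum (kummer_coef a k) z.
Definition kummer' a k z := psum (pseries_diffs (kummer_coef a k)) z.
Definition kummer'' a k z :=
  psum (pseries_diffs (pseries_diffs (kummer_coef a k))) z.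

Lemma is_derive_kummer a k z : is_derive z (1 : R) (kummer a k) (kummer' a k z).
Proof. exact/is_derive_psum/entire_kummer_coef. Qed.

Lemma is_derive_kummer' a k z :
  is_derive z (1 : R) (kummer' a k) (kummer'' a k z).
Proof. exact/is_derive_psum/entire_diffs/entire_kummer_coef. Qed.

Lemma kummer0 a k : kummer a k 0 = 1.
Proof.
rewrite /kummer (psum_split 1) ?expr1 ?mul0r ?addr0; last exact: entire_kummer_coef.
by rewrite big_nat1 kummer_coef0 mulr1.
Qed.

Lemma kummer_ode a k z :
  z * kummer'' a k z = a * kummer a k z - (k.+1%:R - z) * kummer' a k z.
Proof.
have e0 := @entire_kummer_coef a k; have e1 := entire_diffs e0.
rewrite /kummer /kummer' /kummer'' psum_diffs//.
rewrite mulrBl psum_diffs// -!psumZ//.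
have en : entire_coef (fun j => j%:R * kummer_coef a k j).
  apply: (entire_le (entire_shiftr e1)) => -[|j]//=.
  by rewrite mul0r.
have ea := entireZ a e0; have ek := entireZ k.+1%:R e1.
apply/eqP; rewrite opprB addrA eq_sym subr_eq eq_sym; apply/eqP.
rewrite -!psumD//; last first.
  by apply: (entire_le (entire_shiftr (entire_diffs e1))) => -[|j]//=; rewrite mul0r.
congr (psum _ _); apply/funext => j; rewrite /pseries_diffs.
have := kummer_coefS a k j; rewrite natrD -!natr1 => h.
apply/eqP; rewrite -subr_eq0; apply/eqP.
by rewrite -(subr0 (_ - _)) -(subrr ((a + j%:R) * kummer_coef a k j)) -{1}h; ring.
Qed.

(* For z = b / 2 this is, up to the factor e^{-b/4}, the derivative at 1 of the
   regular solution. *)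
Definition neumann_fun a k z := (k%:R - z) * kummer a k z + 2 * z * kummer' a k z.

Definition neumann_coef a k j : R :=
  (k%:R + 2 * j%:R) * kummer_coef a k j - shiftr (kummer_coef a k) j.

Lemma entire_neumann_coef a k : entire_coef (neumann_coef a k).
Proof.
have e0 := @entire_kummer_coef a k.
have en : entire_coef (fun j => j%:R * kummer_coef a k j).
  apply: (entire_le (entire_shiftr (entire_diffs e0))) => -[|j]//=.
  by rewrite mul0r.
have := entireD (entireD (entireZ k%:R e0) (entireZ 2 en)) (entireZ (-1) (entire_shiftr e0)).
move/entire_le; apply => j; rewrite /neumann_coef le_eqVlt; apply/orP; left; apply/eqP.
by congr (`| _ |); ring.
Qed.

Lemma neumann_funE a k z : neumann_fun a k z = psum (neumann_coef a k) z.
Proof.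
have e0 := @entire_kummer_coef a k.
have en : entire_coef (fun j => j%:R * kummer_coef a k j).
  apply: (entire_le (entire_shiftr (entire_diffs e0))) => -[|j]//=.
  by rewrite mul0r.
rewrite /neumann_fun mulrBl -mulrA psum_diffs// -psum_shiftr// -!psumZ//.
rewrite -[- _]mulN1r -psumZ; last exact: entire_shiftr.
have ek := entireZ k%:R e0; have e2 := entireZ 2 en; have es := entireZ (-1) (entire_shiftr e0).
rewrite -psumD// -psumD//; last exact: entireD.
congr (psum _ _); apply/funext => j; rewrite /neumann_coef; ring.
Qed.

Lemma neumann_coef0 a k : neumann_coef a k 0 = k%:R.
Proof. by rewrite /neumann_coef kummer_coef0/=; ring. Qed.

(** The bracket is arranged around a - 1: for a >= 1 it is visibly positive, and for large j the
    square dominates whatever a is. *)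
Lemma neumann_coefS a k j :
  neumann_coef a k j.+1 = kummer_coef a k j *
   (j.+1%:R ^+ 2 + (k%:R + 2 * j.+1%:R) * (a - 1)) / (j.+1%:R * (k + j.+1)%:R).
Proof.
have kj : j.+1%:R * (k + j.+1)%:R != 0 :> R by rewrite -natrM (eqr_nat R _ 0) addnS.
apply: (mulfI kj); rewrite /neumann_coef /= mulrBr mulrCA kummer_coefS.
rewrite [RHS]mulrC divfK//; rewrite natrD -natr1; ring.
Qed.

(* For a = x - p every coefficient of index > p + 1 carries the factor x. *)
Definition tail_coef p k x l : R :=
  k`!%:R * (poch (1 - x) p * (poch (x + 1) l *
   ((l + p + 2)%:R ^+ 2 + (k%:R + 2 * (l + p + 2)%:R) * (x - p%:R - 1))))
   / ((k + (l + p + 2))`!%:R * (l + p + 2)`!%:R).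

Lemma neumann_coef_tail p k x l :
  neumann_coef (x - p%:R) k (l + p + 2) = (-1) ^+ p * x * tail_coef p k x l.
Proof.
rewrite [in LHS]addn2 neumann_coefS /kummer_coef /tail_coef.
(* The factors x - p, ..., x - 1 give (-1)^p times the rising factorial of 1 - x, the next factor is
   x itself, and the last l factors start at x + 1. *)
have -> : poch (x - p%:R) (l + p).+1 =
    (-1) ^+ p * poch (1 - x) p * x * poch (x + 1) l.
  rewrite -addSn addnC addnS -addSn pochD pochS pochN -natr1.
  by rewrite !subrK addrA subrK.
rewrite addn2 !addnS !factS !natrM.
have := factr_neq0 (k + (l + p)); have := factr_neq0 (l + p).
by move=> h1 h2; field; rewrite h1 h2 -?natrD !nat1r_neq0 !pnatr_eq0.
Qed.

(** [head] is the polynomial A and [tail] the series T of the overview. *)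
Definition head p k x z := \sum_(0 <= j < p + 2) neumann_coef (x - p%:R) k j * z ^+ j.
Definition tail p k x z := psum (tail_coef p k x) z.

End Kummer.

(** * Lipschitz dependence on the parameter *)

Section Lipschitz.
Variable R : realType.
Implicit Types (f g : R -> R) (C D c x y z : R) (k p j l : nat).

(** The sup bound is carried along because the Lipschitz constant of a product needs it. One common
    constant keeps the class closed under sums, products and, with constants C / l! for the
    coefficients, power series. *)
Definition bdlip f C := forall x y, `|x| <= 1 -> `|y| <= 1 ->
  `|f x| <= C /\ `|f x - f y| <= C * `|x - y|.

Lemma bdlip_ge0 f C : bdlip f C -> 0 <= C.
Proof.
move=> /(_ 0 0); rewrite normr0 => /(_ ler01 ler01)[h _].
exact: le_trans (normr_ge0 _) h.
Qed.

Lemma bdlip_le f C D : C <= D -> bdlip f C -> bdlip f D.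
Proof.
move=> CD fC x y x1 y1; have [h1 h2] := fC _ _ x1 y1.
by split; [exact: le_trans h1 CD|rewrite (le_trans h2)// ler_wpM2r].
Qed.

Lemma bdlip_cst c : bdlip (fun=> c) `|c|.
Proof. by move=> x y _ _; split => //; rewrite subrr normr0 mulr_ge0. Qed.

Lemma bdlip_id : bdlip id 1.
Proof. by move=> x y x1 y1; rewrite mul1r. Qed.

Lemma bdlipD f g C D : bdlip f C -> bdlip g D -> bdlip (fun x => f x + g x) (C + D).
Proof.
move=> fC gD x y x1 y1; have [f1 f2] := fC _ _ x1 y1; have [g1 g2] := gD _ _ x1 y1.
split; first by rewrite (le_trans (ler_normD _ _))// lerD.
by rewrite opprD addrACA (le_trans (ler_normD _ _))// mulrDl lerD.
Qed.

Lemma bdlipM f g C D : bdlip f C -> bdlip g D -> bdlip (fun x => f x * g x) (2 * (C * D)).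
Proof.
move=> fC gD; have C0 := bdlip_ge0 fC; have D0 := bdlip_ge0 gD.
move=> x y x1 y1; have [f1 f2] := fC _ _ x1 y1; have [g1 g2] := gD _ _ x1 y1.
have [f1' _] := fC _ _ y1 x1.
split.
  rewrite normrM (le_trans (ler_pM _ _ f1 g1))// ler_peMl ?mulr_ge0//.
  by rewrite ler1n.
rewrite (_ : f x * g x - f y * g y = (f x - f y) * g x + f y * (g x - g y)); last by ring.
rewrite (le_trans (ler_normD _ _))// !normrM.
have := ler_pM (normr_ge0 _) (normr_ge0 _) f2 g1.
have := ler_pM (normr_ge0 _) (normr_ge0 _) f1' g2.
lra.
Qed.

Lemma bdlipZ f C c : bdlip f C -> bdlip (fun x => c * f x) (`|c| * C).
Proof.
move=> fC x y x1 y1; have [h1 h2] := fC _ _ x1 y1.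
by rewrite -mulrBr !normrM -mulrA !ler_wpM2l.
Qed.

Lemma bdlip_sum (F : nat -> R -> R) (B : nat -> R) n : (forall j, bdlip (F j) (B j)) ->
  bdlip (fun x => \sum_(0 <= j < n) F j x) (\sum_(0 <= j < n) B j).
Proof.
move=> FB; elim: n => [|n IH] x y x1 y1.
  by rewrite !big_geq// subrr normr0 mul0r.
by rewrite !big_nat_recr//=; exact: bdlipD IH (FB n) x y x1 y1.
Qed.

Lemma bdlip_psum (w : R -> nat -> R) C z : 0 <= z ->
  (forall l, bdlip (w^~ l) (C / l`!%:R)) ->
  bdlip (fun x => psum (w x) z) (C * expR z).
Proof.
move=> z0 wC.
have we x : `|x| <= 1 -> entire_coef (w x).
  move=> x1; exists C, 1 => j; rewrite expr1n mulr1.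
  by have [] := wC j _ _ x1 x1.
have bound (v : nat -> R) D : entire_coef v ->
    (forall l, `|v l| <= D * fact_inv R 0 l) -> `|psum v z| <= D * expR z.
  move=> ve vD; rewrite -psum_fact_inv0 -psumZ; last exact: entire_fact_inv.
  have De := entireZ D (entire_fact_inv R 0).
  rewrite ler_norml; apply/andP; split.
    rewrite -mulN1r -psumZ//; apply: ler_psum => // [|l]; first exact: entireZ.
    by have := vD l; rewrite ler_norml mulN1r => /andP[].
  by apply: ler_psum => // l; have := vD l; rewrite ler_norml => /andP[].
move=> x y x1 y1; split.
  apply: bound => [|l]; first exact: we.
  by rewrite /fact_inv addn0; have [] := wC l _ _ x1 x1.
have eN : entire_coef (fun l => (-1) * w y l) by apply: entireZ; exact: we.
rewrite -mulN1r -psumZ -?psumD; try exact: we; last exact: eN.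
rewrite mulrAC; apply: bound => [|l]; first by apply: entireD => //; exact: we.
rewrite /fact_inv addn0 mulN1r mulrAC.
by have [] := wC l _ _ x1 y1.
Qed.

Definition exbdlip f := exists C, bdlip f C.

Lemma exbdlipD f g : exbdlip f -> exbdlip g -> exbdlip (fun x => f x + g x).
Proof. by move=> [C fC] [D gD]; exists (C + D); exact: bdlipD. Qed.

Lemma exbdlipM f g : exbdlip f -> exbdlip g -> exbdlip (fun x => f x * g x).
Proof. by move=> [C fC] [D gD]; exists (2 * (C * D)); exact: bdlipM. Qed.

Lemma exbdlip_cst c : exbdlip (fun=> c).
Proof. by exists `|c|; exact: bdlip_cst. Qed.

Lemma exbdlip_aff a c : exbdlip (fun x => a * x + c).
Proof.
apply: exbdlipD; last exact: exbdlip_cst.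
by exists (`|a| * 1); exact/bdlipZ/bdlip_id.
Qed.

Lemma exbdlip_poch a c j : exbdlip (fun x => poch (a * x + c) j).
Proof.
elim: j => [|j IH].
  by under eq_fun do rewrite poch0; exact: exbdlip_cst.
under eq_fun do rewrite pochS -addrA.
exact: (exbdlipM IH (exbdlip_aff a (c + j%:R))).
Qed.

Lemma exbdlip_neumann_coef p k j : exbdlip (fun x => neumann_coef (x - p%:R) k j).
Proof.
have kum i : exbdlip (fun x => kummer_coef (x - p%:R) k i).
  have := exbdlipM (exbdlip_cst (k`!%:R / ((k + i)`!%:R * i`!%:R)))
    (exbdlip_poch 1 (- p%:R) i).
  by under eq_fun do rewrite mul1r mulrAC.
have sh : exbdlip (fun x => - shiftr (kummer_coef (x - p%:R) k) j).
  case: j => [|j]/=; first exact: exbdlip_cst.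
  by have := exbdlipM (exbdlip_cst (-1)) (kum j); under eq_fun do rewrite mulN1r.
exact: exbdlipD (exbdlipM (exbdlip_cst _) (kum j)) sh.
Qed.

Lemma head_bdlip p k : exists C, forall z, 1 <= z ->
  bdlip (fun x => head p k x z) (C * z ^+ p.+1).
Proof.
have [B BP] := choice (fun j => exbdlip_neumann_coef p k j).
exists (\sum_(0 <= j < p + 2) B j) => z z1.
rewrite mulr_suml; apply: (@bdlip_le _ (\sum_(0 <= j < p + 2) z ^+ j * B j)).
  rewrite big_nat_cond [leRHS]big_nat_cond ler_sum// => j /andP[/= jp _].
  rewrite mulrC ler_wpM2l ?(bdlip_ge0 (BP j))//.
  by rewrite ler_weXn2l// -ltnS -addn2.
apply: (@bdlip_sum (fun j x => neumann_coef (x - p%:R) k j * z ^+ j)) => j.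
under eq_fun do rewrite mulrC.
rewrite -[X in X * B j]ger0_norm ?exprn_ge0 ?(le_trans _ z1)//.
exact: bdlipZ.
Qed.

(** On [-1, 1] the i-th factor is at most i + 2, so the product is at most (l + 1)!, and the product
    rule adds a factor l. The constant has l + 1 instead of l so that it also covers the sup bound
    at l = 0. *)
Lemma poch_bdlip l : bdlip (fun x => poch (x + 1) l) (l.+1%:R * l.+1`!%:R).
Proof.
move=> x y x1 y1.
suff [h1 h2] : `|poch (x + 1) l| <= l.+1`!%:R /\
  `|poch (x + 1) l - poch (y + 1) l| <= l%:R * l.+1`!%:R * `|x - y|.
  split; first by rewrite (le_trans h1)// ler_peMl// ler1n.
  by rewrite (le_trans h2)// ler_wpM2r// ler_wpM2r// ler_nat.
have f i (t : R) : `|t| <= 1 -> `|t + 1 + i%:R| <= i.+2%:R.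
  move=> t1; rewrite (le_trans (ler_normD _ _))// normr_nat.
  rewrite -addn2 natrD addrC lerD2l (le_trans (ler_normD _ _))// normr1.
  by rewrite -[2]/(1 + 1) lerD2r.
have b i (t : R) : `|t| <= 1 -> `|poch (t + 1) i| <= i.+1`!%:R.
  move=> t1; elim: i => [|i IH]; first by rewrite poch0 normr1.
  by rewrite pochS normrM factS mulnC natrM ler_pM// f.
split; first exact: b.
elim: l => [|l IH]; first by rewrite !poch0 subrr normr0 !mul0r.
rewrite !pochS.
rewrite (_ : _ - _ = (poch (x + 1) l - poch (y + 1) l) * (x + 1 + l%:R)
  + poch (y + 1) l * (x - y)); last by ring.
rewrite (le_trans (ler_normD _ _))// !normrM -nat1r mulrDl mul1r mulrDl addrC lerD//.
  rewrite ler_wpM2r// (le_trans (b _ _ y1))// ler_nat leq_fact//.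
rewrite factS natrM.
rewrite (le_trans (ler_pM _ _ IH (f l _ x1)))//.
by rewrite le_eqVlt; apply/orP; left; apply/eqP; ring.
Qed.

(** The numerator is of size (l + 1)^3 (l + 1)!, whereas the denominator is at least the square of
    (l + 2)!; the surplus leaves the 1 / l! needed for summation. *)
Lemma tail_coef_bdlip p k : exists C, 0 <= C /\
  forall l, bdlip (fun x => tail_coef p k x l) (C / l`!%:R).
Proof.
have [Q QP] := exbdlip_poch (-1) 1 p; have Q0 := bdlip_ge0 QP.
pose D : R := (p + 2)%:R ^+ 2 + (k%:R + 2 * (p + 2)%:R) * (p + 2)%:R.
have D0 : 0 <= D by rewrite addr_ge0 ?exprn_ge0// mulr_ge0// addr_ge0// mulr_ge0.
have Nlip l : bdlip (fun x => (l + p + 2)%:R ^+ 2 + (k%:R + 2 * (l + p + 2)%:R) * (x - p%:R - 1))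
   (D * l.+1%:R ^+ 2).
  have b1 : (l + p + 2)%:R <= (p + 2)%:R * l.+1%:R :> R by rewrite -natrM ler_nat; nia.
  have l1 : 1 <= l.+1%:R :> R by rewrite ler1n.
  have := bdlipD (bdlip_cst ((l + p + 2)%:R ^+ 2))
     (bdlipZ (k%:R + 2 * (l + p + 2)%:R) (bdlipD bdlip_id (bdlip_cst (- (p%:R + 1))))).
  under eq_fun do rewrite opprD addrA.
  apply: bdlip_le.
  rewrite normrN !ger0_norm ?exprn_ge0 ?addr_ge0 ?mulr_ge0//.
  rewrite /D [leRHS]mulrDl lerD//; first by rewrite -exprMn lerXn2r ?nnegrE// mulr_ge0.
  rewrite [X in _ * X <= _](_ : _ = (p + 2)%:R); last by rewrite natrD; ring.
  rewrite mulrAC ler_wpM2r// expr2 mulrA; apply: (@le_trans _ _ ((k%:R + 2 * (p + 2)%:R) * l.+1%:R)).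
    have : k%:R <= k%:R * l.+1%:R :> R by rewrite ler_peMr.
    by lra.
  by rewrite ler_peMr// mulr_ge0// addr_ge0// mulr_ge0.
exists (k`!%:R * (2 * (Q * (2 * D)))); split; first by rewrite !mulr_ge0.
move=> l; rewrite /tail_coef.
have := bdlipZ (k`!%:R / ((k + (l + p + 2))`!%:R * (l + p + 2)`!%:R))
  (bdlipM QP (bdlipM (poch_bdlip l) (Nlip l))).
under eq_fun do rewrite mulrAC mulN1r [- _ + 1]addrC.
apply: bdlip_le; rewrite ger0_norm ?divr_ge0 ?mulr_ge0//.
rewrite ler_pdivlMr ?ltr0n ?fact_gt0//.
rewrite [leLHS](_ : _ = k`!%:R * (2 * (Q * (2 * D))) *
  ((l.+1 ^ 3 * (l.+1`! * l`!))%:R / ((k + (l + p + 2))`! * (l + p + 2)`!)%:R)); last first.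
  by rewrite natrM natrX !natrM; field; rewrite !factr_neq0.
rewrite ler_piMr ?mulr_ge0// ler_pdivrMr ?ltr0n ?muln_gt0 ?fact_gt0// mul1r ler_nat.
apply: (@leq_trans (l.+2`! * l.+2`!)); last by rewrite leq_mul// leq_fact//; lia.
rewrite {1}[l.+2`!]factS [l.+2`!]factS {2}[l.+1`!]factS.
rewrite [leqRHS](_ : _ = (l.+2 * (l.+2 * l.+1)) * (l.+1`! * l`!))%N; last by ring.
by rewrite leq_mul2r; apply/orP; right; rewrite !expnS expn0; nia.
Qed.

Lemma entire_tail_coef p k x : `|x| <= 1 -> entire_coef (tail_coef p k x).
Proof.
move=> x1; have [C [_ CP]] := tail_coef_bdlip p k.
by exists C, 1 => j; rewrite expr1n mulr1; have [] := CP j _ _ x1 x1.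
Qed.

Lemma neumann_fun_split p k x z : `|x| <= 1 ->
  neumann_fun (x - p%:R) k z =
    head p k x z + (-1) ^+ p * x * z ^+ (p + 2) * tail p k x z.
Proof.
move=> x1; rewrite neumann_funE (psum_split (p + 2)) ?entire_neumann_coef//.
  congr (_ + _); rewrite (_ : (fun _ => _) = fun l => (-1) ^+ p * x * tail_coef p k x l).
    by rewrite psumZ; [rewrite /tail; ring|exact: entire_tail_coef].
  by apply/funext => l; rewrite addnA neumann_coef_tail.
exact: entire_neumann_coef.
Qed.

(** The negative powers of z in the true size of T are given up: this constant is only used
    multiplied by a root, which is exponentially small. *)
Lemma tail_bdlip p k : exists C, 0 <= C /\ forall z, 0 <= z ->
  bdlip (fun x => tail p k x z) (C * expR z).
Proof.
have [C [C0 CP]] := tail_coef_bdlip p k; exists C; split => // z z0.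
exact: bdlip_psum.
Qed.

End Lipschitz.

(** * Asymptotics of the tail series *)

Section TailAsymptotics.
Variable R : realType.
Implicit Types (C D c x y z : R) (k p j l : nat).

(* Loses a factor l compared to the true size, which is harmless: an
   exponential lower bound for the tail is all that is needed. *)
Lemma poch_ge_half x l : -2^-1 <= x -> l`!%:R / (2 * l.+1%:R) <= poch (x + 1) l.
Proof.
move=> x1; elim: l => [|l IH]; first by rewrite poch0 fact0; lra.
have l0 : 0 <= l%:R :> R by [].
have f0 : 0 < l`!%:R :> R by rewrite ltr0n fact_gt0.
rewrite pochS; apply: (@le_trans _ _ (l`!%:R / (2 * l.+1%:R) * (2^-1 + l%:R))).
  rewrite factS natrM -!natr1; move: l0 f0; set L : R := l%:R; set F : R := _%:R.
  move=> l0 f0; rewrite -subr_ge0.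
  rewrite (_ : _ - _ = F * L / (4 * (L + 1) * (L + 1 + 1))).
    apply: divr_ge0; first by rewrite mulr_ge0// ltW.
    by rewrite !mulr_ge0// !addr_ge0.
  by field; rewrite !gt_eqF//; lra.
by apply: ler_pM => //; lra.
Qed.

Lemma poch_ge_pow x p : x <= 2^-1 -> 2^-1 ^+ p <= poch (1 - x) p.
Proof.
move=> x1; elim: p => [|p IH]; first by rewrite poch0 expr0.
rewrite pochS exprSr ler_pM//; have : 0 <= p%:R :> R by []. lra.
Qed.

(* The term in C absorbs the finitely many l for which tail_coef may be negative.
   At x = 1 the factor poch (1 - x) p vanishes unless p = 0, hence the two upper
   bounds on x. *)
Lemma tail_coef_ge p k : exists C c : R, 0 < c /\
  forall x l, -2^-1 <= x -> x <= (if p == 0%N then 1 else 2^-1) ->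
    c * fact_inv R (2 * p + k + 4) l - C * fact_inv R (2 * p + k + 4).+1 l <= tail_coef p k x l.
Proof.
have [C0 [C00 C0P]] := tail_coef_bdlip R p k.
(* From [L0] on, the quadratic factor of [tail_coef] is at least half of its leading term. The
   exponent q is the total shift of the two factorials in the denominator, whose product is at most
   l! (l + q)!. *)
pose q := (2 * p + k + 4)%N; pose L0 := (2 * (k + 2) * (p + 2))%N.
pose c : R := k`!%:R * 2^-1 ^+ p / 4.
have c0 : 0 < c by rewrite divr_gt0// mulr_gt0// ?ltr0n ?fact_gt0// exprn_gt0.
exists ((C0 + c) * (L0 + q.+1)`!%:R), c; split => // x l x1 x2.
have x3 : `|x| <= 1.
  by rewrite ler_norml; apply/andP; split; [lra|move: x2; case: ifP => _; lra].
have Q1 : 2^-1 ^+ p <= poch (1 - x) p.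
  by move: x2; case: eqP => [-> _|_]; [rewrite poch0 expr0|exact: poch_ge_pow].
have finv n m : 0 < fact_inv R n m by rewrite invr_gt0 ltr0n fact_gt0.
have [lL|lL] := leqP L0 l.
  apply: (@le_trans _ _ (c * fact_inv R q l)).
    by rewrite gerBl mulr_ge0 ?(ltW (finv _ _))// mulr_ge0// addr_ge0// ltW.
  have [n nE] : exists n, n = (l + p + 2)%N by exists (l + p + 2)%N.
  have N1 : n%:R ^+ 2 / 2 <= n%:R ^+ 2 + (k%:R + 2 * n%:R) * (x - p%:R - 1).
    have : ((k + (n + n)) * (2 * (p + 2)) <= n * n)%N by move: lL; rewrite nE /L0; nia.
    rewrite -(ler_nat R) !natrM !natrD.
    have : 0 <= (k%:R + 2 * n%:R) * (x + 1) :> R.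
      by apply: mulr_ge0; [rewrite addr_ge0// mulr_ge0|lra].
    lra.
  have P1 := poch_ge_half l x1.
  rewrite /tail_coef -nE /fact_inv.
  apply: (@le_trans _ _ (k`!%:R * (2^-1 ^+ p * (l`!%:R / (2 * l.+1%:R) * (n%:R ^+ 2 / 2)))
     / ((k + n)`!%:R * n`!%:R))); last first.
    rewrite ler_wpM2r ?invr_ge0 ?mulr_ge0// ler_wpM2l//.
    by rewrite !ler_pM// ?mulr_ge0 ?divr_ge0 ?exprn_ge0.
  rewrite [leRHS](_ : _ = c * (l`!%:R * n%:R ^+ 2 / (l.+1%:R * ((k + n)`!%:R * n`!%:R)))); last first.
    by rewrite /c; field; rewrite !factr_neq0 nat1r_neq0.
  rewrite ler_wpM2l ?(ltW c0)// ler_pdivlMr ?mulr_gt0 ?ltr0n ?fact_gt0//.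
  rewrite mulrC ler_pdivrMr ?ltr0n ?fact_gt0// -natrX -!natrM ler_nat.
  have h1 : ((k + n)`! * n`! <= l`! * (l + q)`!)%N.
    have e i : ((l + k + i)`! * (l + i)`! <= l`! * (l + k + i + i)`!)%N.
      elim: i => [|i IH]; first by rewrite !addn0 mulnC.
      rewrite !addnS addSn !factS.
      apply: (@leq_trans ((l + k + i).+1 * (l + i).+1 * ((l + k + i)`! * (l + i)`!))).
        by rewrite leq_eqVlt; apply/orP; left; apply/eqP; ring.
      apply: (@leq_trans ((l + k + i + i).+2 * (l + k + i + i).+1 * (l`! * (l + k + i + i)`!))).
        by rewrite leq_mul// leq_mul//; lia.
      by rewrite leq_eqVlt; apply/orP; left; apply/eqP; ring.
    have := e (p + 2)%N.
    rewrite (_ : l + k + (p + 2) + (p + 2) = l + q)%N; last by rewrite /q; lia.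
    rewrite (_ : l + (p + 2) = n)%N; last by rewrite nE; lia.
    by rewrite (_ : l + k + (p + 2) = k + n)%N//; rewrite nE; lia.
  rewrite [leqRHS](_ : _ = n ^ 2 * (l`! * (l + q)`!))%N; last by ring.
  by rewrite leq_mul// expnS expn1 nE; nia.
rewrite lerBlDr; apply: (@le_trans _ _ c).
  by rewrite ler_piMr ?(ltW c0)// /fact_inv invf_le1 ?ltr0n ?fact_gt0// ler1n fact_gt0.
have b1 : - C0 <= tail_coef p k x l.
  have [+ _] := C0P l x x x3 x3; rewrite ler_norml => /andP[+ _].
  apply: le_trans; rewrite lerN2 ler_piMr// invf_le1 ?ltr0n ?fact_gt0//.
  by rewrite ler1n fact_gt0.
have : C0 + c <= (C0 + c) * (L0 + q.+1)`!%:R * fact_inv R q.+1 l.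
  rewrite -mulrA ler_peMr ?addr_ge0 ?(ltW c0)//.
  rewrite /fact_inv ler_pdivlMr ?ltr0n ?fact_gt0// mul1r ler_nat leq_fact//.
  by rewrite leq_add2r ltnW.
lra.
Qed.

(** The comparison series does not involve x, so one threshold for z serves the whole range of x. *)
Lemma tail_ge p k : exists c : R, 0 < c /\
  \forall z \near +oo, forall x, -2^-1 <= x -> x <= (if p == 0%N then 1 else 2^-1) ->
    c * expR z <= z ^+ (2 * p + k + 4) * tail p k x z.
Proof.
have [C [c [c0 CP]]] := tail_coef_ge p k.
exists (c / 2); split; first by rewrite divr_gt0.
pose q := (2 * p + k + 4)%N.
pose w l := c * fact_inv R q l - C * fact_inv R q.+1 l.
have we : entire_coef w.
  apply: (@entire_le _ _ (fun l => c * fact_inv R q l + (- C) * fact_inv R q.+1 l)).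
    by apply: entireD; apply: entireZ; exact: entire_fact_inv.
  by move=> j; rewrite mulNr.
have low := psum_lower we c0 (fun l => lexx _).
near=> z => x x1 x2; apply: (@le_trans _ _ (z ^+ q * psum w z)).
  by near: z; exact: low.
have z0 : 0 <= z by near: z; exact: nbhs_pinfty_ge.
rewrite ler_wpM2l ?exprn_ge0// ler_psum => // [|l]; last exact: CP.
apply: entire_tail_coef.
by rewrite ler_norml; apply/andP; split; [lra|move: x2; case: ifP => _; lra].
Unshelve. all: by end_near. Qed.

(** Convergence to 1 with the rate 1/l that [psum_asympt] requires of the ratio between the actual
    and the model coefficients. *)
Definition tends1 (r : nat -> R) := exists C, forall l, `|r l - 1| <= C / l.+1%:R.

Lemma tends1M r1 r2 : tends1 r1 -> tends1 r2 -> tends1 (fun l => r1 l * r2 l).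
Proof.
move=> [C1 r1C] [C2 r2C]; exists (C1 * C2 + C1 + C2) => l.
have -> : r1 l * r2 l - 1 = (r1 l - 1) * (r2 l - 1) + (r1 l - 1) + (r2 l - 1) by ring.
have C20 : 0 <= C2.
  by have := le_trans (normr_ge0 _) (r2C 0%N); rewrite divr1.
have C10 : 0 <= C1.
  by have := le_trans (normr_ge0 _) (r1C 0%N); rewrite divr1.
rewrite (le_trans (ler_normD _ _))// [leRHS]mulrDl lerD//.
rewrite (le_trans (ler_normD _ _))// [leRHS]mulrDl lerD//.
rewrite normrM (le_trans (ler_pM _ _ (r1C l) (r2C l)))//.
rewrite mulrACA ler_wpM2l ?mulr_ge0// ler_piMr// invf_le1 ?ltr0n//.
by rewrite ler1n.
Qed.

Lemma tends1_ratio u v : tends1 (fun l => (l + u).+1%:R / (l + v).+1%:R).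
Proof.
exists `|u%:R - v%:R| => l.
have -> : (l + u).+1%:R / (l + v).+1%:R - 1 = (u%:R - v%:R) / (l + v).+1%:R :> R.
  by rewrite -!natr1 !natrD; field; rewrite -natrD addrC nat1r_neq0.
rewrite normrM ler_wpM2l// ger0_norm ?invr_ge0// lef_pV2 ?posrE ?ltr0n//.
by rewrite ler_nat ltnS leq_addr.
Qed.

(** Merges a product of two shifted factorials into l! times one factorial that carries the total
    shift. *)
Lemma tends1_fact K i : tends1 (fun l =>
  (l`! * (l + K + i)`!)%:R / ((l + i)`! * (l + K)`!)%:R).
Proof.
elim: i => [|i IH].
  by exists 0 => l; rewrite !addn0 divff ?subrr ?normr0 ?mul0r//.
have := tends1M IH (tends1_ratio (K + i) i).
rewrite /tends1; under eq_exists do under eq_forall do rewrite addnA.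
move=> [C CP]; exists C => l; apply: le_trans (CP l); rewrite le_eqVlt.
apply/orP; left; apply/eqP; congr (`| _ - _|); rewrite !addnS !factS !natrM -!natr1.
by field; rewrite !factr_neq0 -natrD natr1 pnatr_eq0.
Qed.

Lemma poch1 l : poch 1 l = l`!%:R :> R.
Proof.
elim: l => [|l IH]; first by rewrite poch0.
by rewrite pochS IH nat1r factS natrM mulrC.
Qed.

(** At x = 0 the rising factorials are p! and l!. The quadratic factor cancels the two top factors
    of (l + p + 2)! to leading order, and the remaining (l + p)! (l + k + p + 2)! merges into l! (l
    + q)!. *)
Lemma tail0_asympt p k : exists K : R, \forall z \near +oo,
  z * `|z ^+ (2 * p + k + 2) * tail p k 0 z - k`!%:R * p`!%:R * expR z| <= K * expR z.
Proof.
pose q := (2 * p + k + 2)%N; pose c : R := k`!%:R * p`!%:R.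
have c0 : 0 < c by rewrite mulr_gt0// ltr0n fact_gt0.
have t2 : tends1 (fun l => ((l + p + 2)%:R ^+ 2 + (k%:R + 2 * (l + p + 2)%:R) * (0 - p%:R - 1))
    / ((l + p).+1%:R * (l + p + 2)%:R)).
  exists ((k%:R + 3) * (p.+1)%:R) => l.
  have [n nE] : exists n, n = (l + p).+1 by exists (l + p).+1.
  have -> : (l + p + 2)%N = n.+1 by rewrite nE addn2.
  rewrite -nE; have n0 : n%:R != 0 :> R by rewrite nE pnatr_eq0.
  have n1 : n%:R + 1 != 0 :> R by rewrite natr1 pnatr_eq0.
  rewrite [X in `|X|](_ : _ = ((n%:R + 1) - (k%:R + 2 * (n%:R + 1)) * (p%:R + 1)) / (n%:R * (n%:R + 1))); last first.
    by rewrite -natr1; field; rewrite n0 n1.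
  rewrite normrM [X in _ * X <= _]ger0_norm; last by rewrite invr_ge0 mulr_ge0// addr_ge0.
  rewrite ler_pdivrMr; last by rewrite natr1 mulr_gt0// ltr0n nE.
  apply: (@le_trans _ _ ((k%:R + 3) * p.+1%:R * (n%:R + 1))).
    have nR : 0 <= n%:R :> R by []. have pR : 0 <= p%:R :> R by []. have kR : 0 <= k%:R :> R by [].
    have := mulr_ge0 kR nR; have := mulr_ge0 kR pR; have := mulr_ge0 pR nR.
    have := mulr_ge0 (mulr_ge0 kR pR) nR.
    by rewrite ler_norml -natr1 => *; apply/andP; split; lra.
  rewrite -!mulrA ler_wpM2l ?addr_ge0// ler_wpM2l// mulrA ler_peMl ?addr_ge0//.
  by rewrite mulrC ler_pdivlMr ?ltr0n// mul1r ler_nat nE ltnS leq_addr.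
have [C CP] := tends1M (tends1_fact (k + p + 2) p) t2.
have C0 : 0 <= C.
  by have := le_trans (normr_ge0 _) (CP 0%N); rewrite divr1.
have x1 : `|0 : R| <= 1 by rewrite normr0.
apply: (@psum_asympt _ _ q c (c * C * q.+1%:R)); first exact: entire_tail_coef.
move=> l; move: (CP l).
set r := (X in X - 1) => rC.
have -> : tail_coef p k 0 l - c * fact_inv R q l = c * fact_inv R q l * (r - 1).
  rewrite mulrBr mulr1; congr (_ - _).
  rewrite /tail_coef subr0 add0r !poch1 /r /fact_inv /c.
  rewrite (_ : l + (k + p + 2) + p = l + q)%N; last by rewrite /q; lia.
  rewrite (_ : l + (k + p + 2) = k + (l + p + 2))%N; last by lia.
  rewrite {4}[(l + p + 2)%N]addn2 2!factS !natrM -[(l + p).+2]addn2.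
  by field; rewrite !factr_neq0 -!natrD nat1r !pnatr_eq0 addn2.
rewrite normrM ger0_norm; last by rewrite mulr_ge0 ?(ltW c0)// invr_ge0.
rewrite (le_trans (ler_wpM2l _ rC)) ?mulr_ge0 ?(ltW c0) ?invr_ge0//.
rewrite /fact_inv addnS factS natrM invfM.
rewrite [leRHS](_ : _ = c / (l + q)`!%:R * (C * (q.+1%:R / (l + q).+1%:R))); last by ring.
rewrite ler_wpM2l ?divr_ge0 ?(ltW c0)// ler_wpM2l//.
rewrite ler_pdivlMr ?ltr0n// mulrC ler_pdivrMr ?ltr0n//.
by rewrite -natrM ler_nat; nia.
Qed.

(** At a = -p Kummer's function is a polynomial of degree p, a multiple of a Laguerre polynomial, so
    the coefficient of z^{p+1} comes from the term -z M alone. *)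
Lemma head0_asympt p k : exists C : R, forall z, 1 <= z ->
  `|head p k 0 z + (-1) ^+ p * (k`!%:R / (k + p)`!%:R) * z ^+ p.+1| <= C * z ^+ p.
Proof.
exists (\sum_(0 <= j < p.+1) `|neumann_coef (0 - p%:R) k j|) => z z1.
have z0 : 0 <= z by rewrite (le_trans _ z1).
have nc : neumann_coef (0 - p%:R) k p.+1 = - ((-1) ^+ p * (k`!%:R / (k + p)`!%:R)) :> R.
  rewrite /neumann_coef/= /kummer_coef pochS pochN !subr0 poch1 sub0r addNr.
  by rewrite !mulr0 mul0r mulr0 sub0r; congr (- _); field; rewrite !factr_neq0.
rewrite /head addn2 big_nat_recr//= nc mulNr subrK.
rewrite mulr_suml (le_trans (ler_norm_sum _ _ _))//.
rewrite big_nat_cond [leRHS]big_nat_cond ler_sum// => j /andP[/= jp _].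
by rewrite normrM ler_wpM2l// normrX ger0_norm// ler_weXn2l.
Qed.

End TailAsymptotics.

(** * Roots of the Neumann function *)

Section Roots.
Variable R : realType.
Implicit Types (C D c x y z : R) (k p j l : nat).

(** All coefficients are nonnegative. Strict positivity is read off the linear one, because the
    constant coefficient is k and may vanish. *)
Lemma neumann_fun_gt0 a k z : 1 <= a -> 0 < z -> 0 < neumann_fun a k z.
Proof.
move=> a1 z0; have a0 : 0 <= a by rewrite (le_trans _ a1).
have kc j : 0 <= kummer_coef a k j.
  rewrite divr_ge0// mulr_ge0// prodr_ge0// => i _; exact: addr_ge0.
have br j : 0 <= (j.+1%:R ^+ 2 + (k%:R + 2 * j.+1%:R) * (a - 1)).
  by rewrite addr_ge0 ?exprn_ge0// mulr_ge0 ?subr_ge0// addr_ge0// mulr_ge0.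
rewrite neumann_funE.
apply: lt_le_trans (psum_ge 1 (entire_neumann_coef a k) (ltW z0) _).
  rewrite expr1 mulr_gt0// neumann_coefS kummer_coef0 mul1r divr_gt0//.
    by rewrite ltr_pwDl ?expr1n// mulr_ge0 ?subr_ge0// addr_ge0.
case=> [|j]; first by rewrite neumann_coef0.
by rewrite neumann_coefS divr_ge0// mulr_ge0.
Qed.

(* The sets of a = x - p with x in root_range p cover ]-oo, 1]. *)
Definition root_range p x := -2^-1 <= x /\ x <= (if p == 0%N then 1 else 2^-1).

Lemma root_range_norm p x : root_range p x -> `|x| <= 1.
Proof.
by move=> [x1 x2]; rewrite ler_norml; apply/andP; split; [lra|move: x2; case: ifP => _; lra].
Qed.

Lemma exbdlip_continuous f (a b : R) : -1 < a -> b < 1 -> exbdlip f ->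
  {within `[a, b], continuous f}.
Proof.
move=> a1 b1 [C fC]; apply: continuous_in_subspaceT => x; rewrite inE/= in_itv/= => /andP[ax xb].
have C0 := bdlip_ge0 fC.
apply/cvgrPdist_le => /= e e0; near=> y.
have x1 : `|x| <= 1 by rewrite ler_norml; apply/andP; split; lra.
have y1 : `|y| <= 1.
  have : `|x - y| <= Num.min (a + 1) (1 - b).
    near: y; apply: (@cvgr_dist_le _ _ _ _ _ id x cvg_id).
    by rewrite lt_min; apply/andP; split; lra.
  rewrite le_min !ler_norml => /andP[/andP[? ?] /andP[? ?]]; apply/andP; split; lra.
have [_ h] := fC _ _ x1 y1; apply: le_trans h _.
have : `|x - y| <= e / (C + 1).
  near: y; apply: (@cvgr_dist_le _ _ _ _ _ id x cvg_id).
  by rewrite divr_gt0// ltr_wpDl.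
rewrite ler_pdivlMr ?ltr_wpDl// => h; apply: le_trans h.
by rewrite mulrC ler_wpM2l// lerDl.
Unshelve. all: by end_near. Qed.

(** At a root |x| z^{p+2} T equals |A|, which is at most a multiple of z^{p+1}; the lower bound on T
    does the rest. The power of z is not sharp and only starts the bootstrap in [root_asympt]. *)
Lemma root_crude p k : exists K : R, 0 <= K /\ \forall z \near +oo,
  forall x, root_range p x -> neumann_fun (x - p%:R) k z = 0 ->
    `|x| * expR z <= K * z ^+ (2 * p + k + 4).
Proof.
have [Ch ChP] := head_bdlip R p k.
have [ct [ct0 ctP]] := tail_ge R p k.
have Ch0 : 0 <= Ch.
  by have := bdlip_ge0 (ChP 1 (lexx _)); rewrite expr1n mulr1.
exists (Ch / ct); split; first by rewrite divr_ge0// ltW.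
near=> z.
have ctz : forall x, -2^-1 <= x -> x <= (if p == 0%N then 1 else 2^-1) ->
    ct * expR z <= z ^+ (2 * p + k + 4) * tail p k x z.
  by near: z; exact: ctP.
have z1 : 1 <= z by near: z; exact: nbhs_pinfty_ge.
move=> x xr x0.
have z0 : 0 < z by rewrite (lt_le_trans _ z1).
have x1 := root_range_norm xr.
move: x0; rewrite neumann_fun_split// => x0.
have tl : ct * expR z <= z ^+ (2 * p + k + 4) * tail p k x z.
  by case: xr => *; exact: ctz.
have [hx _] := ChP _ z1 _ _ x1 x1.
have T0 : 0 < tail p k x z.
  by rewrite -(@pmulr_rgt0 _ (z ^+ (2 * p + k + 4))) ?exprn_gt0// (lt_le_trans _ tl)// mulr_gt0// expR_gt0.
have e1 : `|x| * (z ^+ (p + 2) * tail p k x z) <= Ch * z ^+ p.+1.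
  apply: le_trans hx; move/eqP: x0; rewrite addr_eq0 => /eqP ->.
  rewrite normrN !normrM normrX normrN1 expr1n mul1r -mulrA (ger0_norm (ltW T0)).
  by rewrite (ger0_norm (exprn_ge0 _ (ltW z0))) mulrA.
rewrite mulrAC ler_pdivlMr//.
rewrite -(@ler_pM2r _ (z ^+ (p + 2))) ?exprn_gt0//.
apply: (@le_trans _ _ (`|x| * (z ^+ (p + 2) * tail p k x z) * z ^+ (2 * p + k + 4))).
  rewrite [leLHS](_ : _ = `|x| * z ^+ (p + 2) * (ct * expR z)); last by ring.
  rewrite [leRHS](_ : _ = `|x| * z ^+ (p + 2) * (z ^+ (2 * p + k + 4) * tail p k x z)); last by ring.
  by rewrite ler_wpM2l// mulr_ge0// exprn_ge0// ltW.
apply: le_trans (ler_wpM2r _ e1) _; first by rewrite exprn_ge0// ltW.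
rewrite mulrAC ler_wpM2l//; first by rewrite mulr_ge0// exprn_ge0// ltW.
by rewrite ler_weXn2l// addn2.
Unshelve. all: by end_near. Qed.

(* Two roots satisfy |x - y| z^{p+2} T(x) <= |x - y| (Lip(A) + z^{p+2} |y| Lip(T)),
   where |y| e^z and Lip(T) e^{-z} are bounded by powers of z: unless x = y, this
   bounds e^z by a power of z. *)
Lemma root_unique p k : \forall z \near +oo,
  forall x y, root_range p x -> root_range p y ->
    neumann_fun (x - p%:R) k z = 0 -> neumann_fun (y - p%:R) k z = 0 -> x = y.
Proof.
have [Ch ChP] := head_bdlip R p k.
have [Ct [Ct0 CtP]] := tail_bdlip R p k.
have [ct [ct0 ctP]] := tail_ge R p k.
have [K [K0 KP]] := root_crude p k.
have Ch0 : 0 <= Ch.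
  by have := bdlip_ge0 (ChP 1 (lexx _)); rewrite expr1n mulr1.
pose q := (2 * p + k + 4)%N.
near=> z.
have z1 : 1 <= z by near: z; exact: nbhs_pinfty_ge.
have ctz : forall x, -2^-1 <= x -> x <= (if p == 0%N then 1 else 2^-1) ->
    ct * expR z <= z ^+ (2 * p + k + 4) * tail p k x z.
  by near: z; exact: ctP.
have Kz : forall x, root_range p x -> neumann_fun (x - p%:R) k z = 0 ->
    `|x| * expR z <= K * z ^+ (2 * p + k + 4).
  by near: z; exact: KP.
have Kf : (Ch + Ct * K + 1) / ct * z ^+ (q + q) <= expR z.
  by near: z; exact: pow_le_expR.
move=> x y xr yr x0 y0; apply/eqP; apply: contraT => xy.
have z0 : 0 < z by rewrite (lt_le_trans _ z1).
have zn n : 0 < z ^+ n by rewrite exprn_gt0.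
have x1 := root_range_norm xr; have y1 := root_range_norm yr.
have yK : `|y| * expR z <= K * z ^+ q by exact: Kz.
have tl : ct * expR z <= z ^+ q * tail p k x z.
  by case: xr => *; exact: ctz.
move: x0 y0; rewrite !neumann_fun_split// => x0 y0.
have [_ hxy] := ChP _ z1 _ _ x1 y1.
have [_ txy] := CtP _ (ltW z0) _ _ x1 y1.
have T0 : 0 < tail p k x z.
  by rewrite -(@pmulr_rgt0 _ (z ^+ q))// (lt_le_trans _ tl)// mulr_gt0// expR_gt0.
have e1 : (-1) ^+ p * ((x - y) * (z ^+ (p + 2) * tail p k x z)) =
    - (head p k x z - head p k y z)
    - (-1) ^+ p * (y * z ^+ (p + 2) * (tail p k x z - tail p k y z)).
  by move: x0 y0 => /eqP + /eqP; rewrite !addr_eq0 => /eqP -> /eqP ->; ring.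
have e2 : `|x - y| * (z ^+ (p + 2) * tail p k x z) <=
    `|x - y| * (Ch * z ^+ p.+1 + Ct * K * z ^+ (p + 2 + q)).
  rewrite -[X in _ * X <= _]ger0_norm; last by rewrite mulr_ge0 ?ltW.
  rewrite -normrM -(mul1r `|_ * _|) -[X in X * _ <= _](expr1n _ p) -(normrN1 R).
  rewrite -normrX -normrM e1 (le_trans (ler_normB _ _))// [leRHS]mulrDr normrN lerD//.
    by rewrite mulrC.
  rewrite !normrM normrX normrN1 expr1n mul1r [leRHS](_ : _ = (K * z ^+ q) * (z ^+ (p + 2) * Ct * `|x - y|)); last by rewrite exprD; ring.
  apply: le_trans (ler_wpM2r _ yK); last by rewrite !mulr_ge0// ltW.
  rewrite (gtr0_norm (zn _)) [leRHS](_ : _ = `|y| * z ^+ (p + 2) * (Ct * expR z * `|x - y|)); last by ring.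
  by rewrite ler_wpM2l// mulr_ge0// ltW.
move: e2; rewrite ler_pM2l ?normr_gt0 ?subr_eq0//.
move=> e2.
have e3 : tail p k x z <= (Ch + Ct * K) * z ^+ q.
  rewrite -(@ler_pM2l _ (z ^+ (p + 2)))// (le_trans e2)//.
  rewrite [leRHS](_ : _ = Ch * z ^+ (p + 2 + q) + Ct * K * z ^+ (p + 2 + q)); last first.
    by rewrite (exprD _ (p + 2) q); ring.
  rewrite lerD2r.
  apply: ler_wpM2l => //.
  apply: ler_weXn2l => //.
  by rewrite addn2 !addSn ltnS leqW// leq_addr.
have e4 : ct * expR z <= (Ch + Ct * K) * z ^+ (q + q).
  by apply: le_trans tl _; rewrite exprD mulrCA ler_wpM2l// ltW.
move: Kf; rewrite mulrAC ler_pdivrMr// mulrC; have := zn (q + q)%N; lra.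
Unshelve. all: by end_near. Qed.

(** At x = 1/2 and x = -1/2 the term with T outweighs A as soon as T >= 2 [Ch] + 1, so the function
    has opposite signs there and the intermediate value theorem applies. *)
Lemma root_exists p k : \forall z \near +oo,
  exists x, root_range p x /\ neumann_fun (x - p%:R) k z = 0.
Proof.
have [Ch ChP] := head_bdlip R p k.
have [Ct [Ct0 CtP]] := tail_bdlip R p k.
have [ct [ct0 ctP]] := tail_ge R p k.
have Ch0 : 0 <= Ch.
  by have := bdlip_ge0 (ChP 1 (lexx _)); rewrite expr1n mulr1.
pose q := (2 * p + k + 4)%N.
near=> z.
have z1 : 1 <= z by near: z; exact: nbhs_pinfty_ge.
have z0 : 0 < z by rewrite (lt_le_trans _ z1).
have zn n : 0 < z ^+ n by rewrite exprn_gt0.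
have ctz : forall x, -2^-1 <= x -> x <= (if p == 0%N then 1 else 2^-1) ->
    ct * expR z <= z ^+ (2 * p + k + 4) * tail p k x z.
  by near: z; exact: ctP.
have Ez : ct^-1 * (2 * Ch + 1) * z ^+ q <= expR z.
  by near: z; exact: pow_le_expR.
have tl x : root_range p x -> 2 * Ch + 1 <= tail p k x z.
  move=> [x1 x2]; rewrite -(@ler_pM2l _ (z ^+ q))//.
  have : ct * expR z <= z ^+ q * tail p k x z.
    exact: ctz.
  apply: le_trans; rewrite mulrC -ler_pdivrMl//.
  by rewrite mulrA.
pose f x := head p k x z + (-1) ^+ p * z ^+ (p + 2) * (x * tail p k x z).
have ff x : `|x| <= 1 -> neumann_fun (x - p%:R) k z = f x.
  by move=> x1; rewrite neumann_fun_split// /f; ring.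
have fc : {within `[-2^-1, 2^-1], continuous f}.
  apply: exbdlip_continuous; [lra|lra|].
  apply: exbdlipD; first by exists (Ch * z ^+ p.+1); exact: ChP.
  apply: exbdlipM; first exact: exbdlip_cst.
  apply: exbdlipM; first by exists 1; exact: bdlip_id.
  by exists (Ct * expR z); exact/CtP/ltW.
have r1 : root_range p 2^-1 by split; [lra|case: ifP => _; lra].
have r2 : root_range p (- 2^-1) by split; [lra|case: ifP => _; lra].
have hd x : root_range p x -> `|head p k x z| < z ^+ (p + 2) * (2^-1 * tail p k x z).
  move=> xr; have x1 := root_range_norm xr.
  have [h _] := ChP _ z1 _ _ x1 x1; apply: le_lt_trans h _.
  apply: (@lt_le_trans _ _ (z ^+ p.+1 * (2^-1 * tail p k x z))).
    by rewrite mulrC ltr_pM2l//; have := tl _ xr; lra.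
  rewrite ler_wpM2r//; first by have := tl _ xr; lra.
  by rewrite ler_weXn2l// addn2.
have s1 : 0 < (-1) ^+ p * f 2^-1.
  have := hd _ r1; rewrite /f mulrDr !mulrA -expr2 sqrr_sign mul1r.
  rewrite ltr_norml => /andP[h1 h2]; rewrite -signr_odd.
  by case: (odd p); rewrite ?expr1 ?expr0; lra.
have s2 : (-1) ^+ p * f (- 2^-1) < 0.
  have := hd _ r2; rewrite /f mulrDr !mulrA -expr2 sqrr_sign mul1r.
  rewrite ltr_norml => /andP[h1 h2]; rewrite -signr_odd.
  by case: (odd p); rewrite ?expr1 ?expr0; lra.
have [|||x] := @IVT _ f (-2^-1) 2^-1 0.
- lra.
- exact: fc.
- move: s1 s2; rewrite -signr_odd.
  by case: (odd p); rewrite ?expr1 ?expr0 ?mul1r ?mulN1r ?oppr_gt0 ?oppr_lt0 => h1 h2;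
    rewrite ge_min le_max (ltW h1) (ltW h2) ?orbT.
rewrite in_itv/= => /andP[x1 x2] fx; exists x.
have xr : root_range p x by split; [|case: ifP => _; lra].
by split => //; rewrite ff// (root_range_norm xr).
Unshelve. all: by end_near. Qed.

(** A bootstrap: the crude bound shows that T(x) is comparable to T(0), this sharpens the bound on
    |x| e^z to a multiple of z^{2p+k+1}, and with the sharp bound every error in the linearized
    equation is O(z^{2p+k}). *)
Lemma root_asympt p k : exists C : R, \forall z \near +oo,
  forall x, root_range p x -> neumann_fun (x - p%:R) k z = 0 ->
    `|x - z ^+ (2 * p + k).+1 / (p`!%:R * (k + p)`!%:R) * expR (- z)|
      <= C * z ^+ (2 * p + k) * expR (- z).
Proof.
have [Ch ChP] := head_bdlip R p k.
have [Ct [Ct0 CtP]] := tail_bdlip R p k.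
have [K0 [K00 K0P]] := root_crude p k.
have [K2 K2P] := tail0_asympt R p k.
have [K3 K3P] := head0_asympt R p k.
have Ch0 : 0 <= Ch.
  by have := bdlip_ge0 (ChP 1 (lexx _)); rewrite expr1n mulr1.
have K30 : 0 <= K3.
  by have := le_trans (normr_ge0 _) (K3P 1 (lexx _)); rewrite expr1n mulr1.
pose r := (2 * p + k)%N; have qn : (2 * p + k + 2 = p + k + (p + 2))%N by lia.
have rn : (2 * p + k = p + k + p)%N by lia.
pose q := (2 * p + k + 2)%N; pose N := (q + r.+1)%N.
(* [F] and [H] are the leading constants of T and, up to sign, of A at x = 0; the root is H / F
   times z^{2p+k+1} e^{-z} to leading order. *)
pose F : R := k`!%:R * p`!%:R; pose H : R := k`!%:R / (k + p)`!%:R.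
have F0 : 0 < F by rewrite mulr_gt0// ltr0n fact_gt0.
pose K4 := 2 * Ch / F; have K40 : 0 <= K4 by rewrite divr_ge0 ?mulr_ge0// ltW.
exists ((K4 * `|K2| + Ct * K4 + Ch + K3) / F).
near=> z.
have z1 : 1 <= z by near: z; exact: nbhs_pinfty_ge.
have z0 : 0 < z by rewrite (lt_le_trans _ z1).
have zn n : 0 < z ^+ n by rewrite exprn_gt0.
have zn1 n : 1 <= z ^+ n by rewrite exprn_ege1.
have E0 := expR_gt0 z.
have Kz : forall x, root_range p x -> neumann_fun (x - p%:R) k z = 0 ->
    `|x| * expR z <= K0 * z ^+ (r + 4).
  by near: z; exact: K0P.
have T0z : z * `|z ^+ q * tail p k 0 z - F * expR z| <= K2 * expR z.
  by near: z; exact: K2P.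
have K2z : 4 * K2 / F <= z by near: z; apply: nbhs_pinfty_ge; exact: num_real.
have CKz : 4 * Ct * K0 / F * z ^+ (q + (r + 4)) <= expR z.
  by near: z; exact: pow_le_expR.
have K4z : K4 * z ^+ (N + r.+1) <= expR z by near: z; exact: pow_le_expR.
move=> x xr x0; have x1 := root_range_norm xr.
have o1 : `|0 : R| <= 1 by rewrite normr0.
have xK := Kz _ xr x0.
move: x0; rewrite neumann_fun_split// => x0.
have [hx hx0] := ChP _ z1 _ _ x1 o1.
have [_ tx0] := CtP _ (ltW z0) _ _ x1 o1.
move: hx0 tx0; rewrite subr0 => hx0 tx0.
set E := expR z in E0 Kz T0z CKz K4z xK tx0 *.
set Tx := tail p k x z in x0 tx0 *; set T0 := tail p k 0 z in T0z tx0 *.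
set hX := head p k x z in x0 hx hx0 *.
set h0 := head p k 0 z in hx0 *.
have qE : z ^+ q = z ^+ (p + k) * z ^+ (p + 2) by rewrite -exprD -qn.
have rE : z ^+ r.+1 = z ^+ (p + k) * z ^+ p.+1 by rewrite -exprD addnS -rn.
have rE' : z ^+ r = z ^+ (p + k) * z ^+ p by rewrite -exprD -rn.
have sE : (-1) ^+ p * (-1) ^+ p = 1 :> R by rewrite -expr2 sqrr_sign.
have xT : x * (z ^+ q * Tx) = - ((-1) ^+ p * z ^+ (p + k) * hX).
  move/eqP: x0; rewrite addr_eq0 => /eqP ->; rewrite qE.
  rewrite [RHS](_ : _ = (-1) ^+ p * (-1) ^+ p * (x * (z ^+ (p + k) * z ^+ (p + 2) * Tx))).
    by rewrite sE mul1r.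
  by ring.
have normT : `|z ^+ q * T0 - F * E| <= F / 4 * E.
  rewrite -(ler_pM2l z0) (le_trans T0z)// mulrA ler_wpM2r ?(ltW E0)//.
  by move: K2z; rewrite ler_pdivrMr//; lra.
have Tge : F / 2 * E <= z ^+ q * Tx.
  have : `|z ^+ q * (Tx - T0)| <= F / 4 * E.
    rewrite normrM (gtr0_norm (zn _)).
    apply: (@le_trans _ _ (z ^+ q * (Ct * (K0 * z ^+ (r + 4))))).
      rewrite ler_wpM2l ?(ltW (zn _))// (le_trans tx0)// -mulrA ler_wpM2l//.
      by rewrite mulrC.
    rewrite [leLHS](_ : _ = F / 4 * (4 * Ct * K0 / F * z ^+ (q + (r + 4)))).
      by rewrite ler_wpM2l// divr_ge0// ltW.
    by rewrite (exprD z q (r + 4)); field; rewrite gt_eqF.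
  move: normT; rewrite mulrBr !ler_norml => /andP[? ?] /andP[? ?]; lra.
(* The power r + 1 is the one required: the relative error 1/z of T(0), multiplied by x e^z, must
   stay below a multiple of z^r. *)
have xE : `|x| * E <= K4 * z ^+ r.+1.
  have : `|x| * (F / 2 * E) <= Ch * z ^+ r.+1.
    rewrite (le_trans (ler_wpM2l (normr_ge0 x) Tge))//.
    rewrite -[z ^+ q * Tx]ger0_norm; last by rewrite (le_trans _ Tge)// mulr_ge0 ?divr_ge0// ltW.
    rewrite -normrM xT normrN !normrM normrX normrN1 expr1n mul1r (gtr0_norm (zn _)) rE.
    by rewrite mulrCA ler_wpM2l// ltW.
  rewrite /K4 => h; rewrite -(ler_pM2l F0).
  rewrite [leRHS](_ : _ = 2 * (Ch * z ^+ r.+1)); last by field; rewrite gt_eqF.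
  by move: h; lra.
have xN : `|x| * z ^+ N <= 1.
  rewrite -(ler_pM2r E0) mul1r (le_trans _ K4z)// mulrAC exprD.
  by rewrite [leRHS](_ : _ = K4 * z ^+ r.+1 * z ^+ N); [rewrite ler_wpM2r// ltW|ring].
have main : `|F * E * x - H * z ^+ r.+1| <= (K4 * `|K2| + Ct * K4 + Ch + K3) * z ^+ r.
  (* Four errors: the asymptotics of T at 0, the replacement of x by 0 in T and in A, and the lower
     order terms of A at 0. *)
  have -> : F * E * x - H * z ^+ r.+1 = x * (F * E - z ^+ q * T0) + x * (z ^+ q * (T0 - Tx))
      - (-1) ^+ p * z ^+ (p + k) * (hX - h0)
      - (-1) ^+ p * z ^+ (p + k) * (h0 + (-1) ^+ p * H * z ^+ p.+1).
    rewrite rE; have -> : x * (z ^+ q * (T0 - Tx)) = x * (z ^+ q * T0) - x * (z ^+ q * Tx) by ring.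
    by rewrite xT -[H in LHS]mul1r -{1}sE; ring.
  rewrite (le_trans (ler_normB _ _))// [leRHS]mulrDl lerD//; last first.
    rewrite !normrM normrX normrN1 expr1n mul1r (gtr0_norm (zn _)) rE'.
    rewrite [leRHS](_ : _ = z ^+ (p + k) * (K3 * z ^+ p)); last by ring.
    by apply: ler_wpM2l; [exact: ltW|exact: K3P].
  rewrite (le_trans (ler_normB _ _))// [leRHS]mulrDl lerD//; last first.
    rewrite !normrM normrX normrN1 expr1n mul1r (gtr0_norm (zn _)).
    apply: (@le_trans _ _ (Ch * (`|x| * z ^+ N))).
      rewrite (le_trans (ler_wpM2l (ltW (zn _)) hx0))//.
      rewrite [leLHS](_ : _ = Ch * (`|x| * z ^+ r.+1)); last by rewrite rE; ring.
      by rewrite ler_wpM2l// ler_wpM2l// ler_weXn2l// leq_addl.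
    rewrite (@le_trans _ _ (Ch * 1)) ?ler_wpM2l//.
  rewrite (le_trans (ler_normD _ _))// [leRHS]mulrDl lerD//.
    rewrite normrM distrC -(ler_pM2l z0) mulrCA.
    rewrite (le_trans (ler_wpM2l (normr_ge0 x) T0z))//.
    rewrite (@le_trans _ _ (`|K2| * (`|x| * E)))//.
      by rewrite mulrCA ler_wpM2r// ?ler_norm// mulr_ge0// ltW.
    rewrite [leRHS](_ : _ = `|K2| * (K4 * z ^+ r.+1)); last by rewrite exprS; ring.
    by rewrite ler_wpM2l.
  rewrite !normrM (gtr0_norm (zn _)) distrC.
  apply: (@le_trans _ _ (Ct * (`|x| * z ^+ q) * (`|x| * E))).
    rewrite [leRHS](_ : _ = `|x| * (z ^+ q * (Ct * E * `|x|))); last by ring.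
    by rewrite ler_wpM2l// ler_wpM2l// ltW.
  apply: (@le_trans _ _ (Ct * (`|x| * z ^+ q) * (K4 * z ^+ r.+1))).
    by rewrite ler_wpM2l// !mulr_ge0// ltW.
  rewrite [leLHS](_ : _ = Ct * K4 * (`|x| * z ^+ N)); last by rewrite /N exprD; ring.
  apply: ler_wpM2l; first exact: mulr_ge0.
  exact: le_trans xN (zn1 r).
rewrite expRN -/E -(ler_pM2l (mulr_gt0 F0 E0)).
rewrite -{1}(gtr0_norm (mulr_gt0 F0 E0)) -normrM mulrBr.
rewrite [X in _ - X](_ : _ = H * z ^+ r.+1).
  rewrite [leRHS](_ : _ = (K4 * `|K2| + Ct * K4 + Ch + K3) * z ^+ r)//.
  by rewrite /r; field; rewrite !gt_eqF.
by rewrite /F /H /r; field; rewrite !factr_neq0 gt_eqF.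
Unshelve. all: by end_near. Qed.

End Roots.

(** * Local absolute continuity and classical derivatives *)

Section AbsolutelyContinuous.
Variable R : realType.
Local Notation mu := (@lebesgue_measure R).
Local Notation I01 := (`]0, 1[%classic : set R).
Implicit Types (f g : R -> R) (r s t : R).

Lemma is_derive_continuous f (df r : R) : is_derive r 1 f df -> {for r, continuous f}.
Proof.
by move=> [fr _]; exact/differentiable_continuous/derivable1_diffP.
Qed.

Lemma continuous_segment f s t : (forall r, s <= r <= t -> {for r, continuous f}) ->
  {within `[s, t], continuous f}.
Proof.
by move=> fc; apply: continuous_in_subspaceT => r; rewrite inE/= in_itv/= => /fc.
Qed.

Lemma is_derive_MVT f df s t : s <= t ->
  (forall r, s <= r <= t -> is_derive r 1 f (df r)) ->
  exists2 c, s <= c <= t & f t - f s = df c * (t - s).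
Proof.
move=> st fd; have [r||c] := @MVT_segment _ f df s t st.
- by rewrite in_itv/= => /andP[? ?]; apply: fd; rewrite !ltW.
- by apply: continuous_segment => r /fd; exact: is_derive_continuous.
- by rewrite in_itv/= => ?; exists c.
Qed.

Lemma is_derive_ndecr f df s t : s <= t ->
  (forall r, s <= r <= t -> is_derive r 1 f (df r)) ->
  (forall r, s <= r <= t -> 0 <= df r) -> f s <= f t.
Proof.
move=> st fd df0; have [c cst E] := is_derive_MVT st fd.
by rewrite -subr_ge0 E mulr_ge0 ?df0// subr_ge0.
Qed.

Lemma is_derive0_eq f s t : s <= t ->
  (forall r, s <= r <= t -> is_derive r 1 f 0) -> f t = f s.
Proof.
move=> st fd; have [c cst E] := is_derive_MVT st fd.
by apply/eqP; rewrite -subr_eq0 E mul0r.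
Qed.

Lemma Rintegral_is_derive f g s t : s <= t ->
  (forall r, s <= r <= t -> is_derive r 1 f (g r)) ->
  (forall r, s <= r <= t -> {for r, continuous g}) ->
  mu.-integrable `[s, t] (EFin \o g) /\ f t - f s = \int[mu]_(r in `[s, t]) g r.
Proof.
move=> st fd gc; have gw := continuous_segment gc; split.
  by apply: continuous_compact_integrable => //; exact: segment_compact.
move: st fd gc gw; rewrite le_eqVlt => /predU1P[-> _ _ _|st fd gc gw].
  by rewrite set_itv1 Rintegral_set1 subrr.
have fc r : s <= r <= t -> {for r, continuous f}.
  by move=> /fd; exact: is_derive_continuous.
rewrite /Rintegral (@continuous_FTC2 _ g f)//.
  split.
  - by move=> r; rewrite in_itv/= => /andP[sr rt]; have [] : is_derive r 1 f (g r) by apply: fd; rewrite !ltW.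
  - by apply: cvg_at_right_filter; apply: fc; rewrite lexx ltW.
  - by apply: cvg_at_left_filter; apply: fc; rewrite lexx ltW.
move=> r; rewrite in_itv/= => /andP[sr rt].
have rst : s <= r <= t by rewrite !ltW.
by have rd := fd _ rst; rewrite derive1E derive_val.
Qed.

Lemma AC_loc_smooth f g : (forall r, 0 < r < 1 -> is_derive r 1 f (g r)) ->
  (forall r, 0 < r < 1 -> {for r, continuous g}) -> AC_loc f.
Proof.
move=> fd gc s t s0 st t1.
have sub r : s <= r <= t -> 0 < r < 1.
  by move=> /andP[sr rt]; rewrite (lt_le_trans s0)//= (le_lt_trans rt).
have E r : r \in `[s, t]%classic -> derive1 f r = g r.
  rewrite inE/= in_itv/= => /sub rst.
  by have rd := fd _ rst; rewrite derive1E derive_val.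
have [gi fE] := @Rintegral_is_derive f g s t st (fun r rst => fd r (sub r rst)) (fun r rst => gc r (sub r rst)).
split; last by rewrite fE; apply: eq_Rintegral => r /E ->.
by apply: eq_integrable gi => // r /E /= ->.
Qed.

Lemma AC_loc_near f r : 0 < r < 1 -> AC_loc f ->
  \forall y \near r, f y = f (r / 2) + \int[mu]_(u in `[r / 2, y]) derive1 f u.
Proof.
move=> /andP[r0 r1] fA; near=> y.
have [_ <-] : mu.-integrable `[r / 2, y] (EFin \o derive1 f) /\
   f y - f (r / 2) = \int[mu]_(u in `[r / 2, y]) derive1 f u.
  apply: fA; first by rewrite divr_gt0.
    by apply: ltW; near: y; apply: lt_nbhsr; lra.
  by near: y; apply: lt_nbhsl.
by rewrite addrC subrK.
Unshelve. all: by end_near. Qed.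

Lemma AC_loc_continuous f r : 0 < r < 1 -> AC_loc f -> {for r, continuous f}.
Proof.
move=> r01 fA; have /andP[r0 r1] := r01.
have rp : 0 < r / 2 by lra.
have rt : r / 2 <= (1 + r) / 2 by lra.
have t1 : (1 + r) / 2 < 1 by lra.
have [fi _] := fA _ _ rp rt t1.
have := parameterized_integral_continuous rt fi.
move=> /continuous_within_itvP [|c _ _]; first lra.
have cr : {for r, continuous (fun y => f (r / 2) + \int[mu]_(u in `[r / 2, y]) derive1 f u)}.
  apply: continuousD; first exact: cst_continuous.
  by apply: c; rewrite in_itv/=; lra.
have nr := AC_loc_near r01 fA.
rewrite /prop_for /continuous_at (nbhs_singleton nr).
apply: cvg_trans cr; apply: near_eq_cvg.
by apply: filterS nr => y ->.
Qed.

(** Changing the derivative on a null set does not change the integral that represents f, and the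
    integral of a continuous function is differentiable everywhere. This turns an equation valid
    almost everywhere into a classical one. *)
Lemma AC_loc_is_derive f g r : 0 < r < 1 -> AC_loc f ->
  (forall u, 0 < u < 1 -> {for u, continuous g}) ->
  {ae mu, forall u, I01 u -> derive1 f u = g u} ->
  is_derive r 1 f (g r).
Proof.
move=> r01 fA gc fg; have /andP[r0 r1] := r01.
pose G y := \int[mu]_(u in `[r / 2, y]) g u.
have gi t : t < 1 -> mu.-integrable `[r / 2, t] (EFin \o g).
  move=> t1; apply: continuous_compact_integrable; first exact: segment_compact.
  apply: continuous_segment => u /andP[u1 u2]; apply: gc; apply/andP; split; lra.
have rt : r < (1 + r) / 2 by lra.
have [|||Gd GE] := @continuous_FTC1_closed _ g (r / 2) r _ rt.
- apply: gi; lra.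
- lra.
- exact: gc.
have {}Gd : is_derive r 1 G (g r) by apply: (DeriveDef Gd); rewrite -derive1E.
apply: (@near_eq_is_derive _ _ _ (fun y => f (r / 2) + G y)).
  have nr := AC_loc_near r01 fA.
  near=> y; rewrite (near nr y)//; congr (_ + _).
  have y1 : y < 1 by near: y; apply: lt_nbhsl.
  have ry : r / 2 <= y by apply: ltW; near: y; apply: lt_nbhsr; lra.
  rewrite /G /Rintegral; congr fine.
  have rp : 0 < r / 2 by lra.
  have [fi _] := fA (r / 2) y rp ry y1.
  apply: ae_eq_integral => //.
  - by have /integrableP[] := gi _ y1.
  - by have /integrableP[] := fi.
  move: fg; apply: filterS; first exact: (ae_filter_ringOfSetsType mu).
  move=> u fgu; rewrite /= in_itv/= => /andP[u1 u2].
  by rewrite fgu//= in_itv/=; apply/andP; split; lra.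
by have := is_deriveD (is_derive_cst (f (r / 2)) r 1) Gd; rewrite add0r.
Unshelve. all: by end_near. Qed.

Lemma AC_loc_is_derive1 f r : 0 < r < 1 -> AC_loc f ->
  (forall u, 0 < u < 1 -> {for u, continuous (derive1 f)}) ->
  is_derive r 1 f (derive1 f r).
Proof. by move=> r01 fA fc; apply: AC_loc_is_derive => //; apply: aeW. Qed.

End AbsolutelyContinuous.

(** * The regular solution *)

Section RegularSolution.
Variable R : realType.
Implicit Types (F : R -> R) (a b r x : R) (j k : nat).

Lemma continuous_bounded01 F : continuous F ->
  exists C, 0 < C /\ forall r, 0 <= r <= 1 -> `|F r| <= C.
Proof.
move=> Fc.
have nc : {within `[0, 1], continuous (fun r => `|F r|)}.
  by apply: continuous_subspaceT => r; apply: continuous_comp; [exact: Fc|exact: norm_continuous].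
have [c _ cP] := EVT_max (@ler01 R) nc.
exists (`|F c| + 1); split; first by rewrite ltr_wpDl.
move=> r r01; by rewrite (le_trans (cP r _)) ?lerDl.
Qed.

(* r^j e^{-s/2} F(s) with s = b r^2 / 2. *)
Definition gauss_mono b j F r :=
  r ^+ j * (expR (- (b * r ^+ 2 / 4)) * F (b * r ^+ 2 / 2)).

(** The family is closed under differentiation, so both derivatives of the regular solution stay in
    it. At j = 0 the truncated predecessor is harmless because its coefficient j vanishes. *)
Lemma is_derive_gauss_mono b j F F' r :
  (forall s : R, is_derive s 1 F (F' s)) ->
  is_derive r 1 (gauss_mono b j F)
    (j%:R * gauss_mono b j.-1 F r
     + gauss_mono b j.+1 (fun s => b * F' s - b / 2 * F s) r).
Proof.
move=> FD.
have d2 c : is_derive r 1 (fun r => c * r ^+ 2) (c * (2 * r)).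
  apply: (is_derive_eq (is_deriveZ c (is_deriveX 2 (is_derive_id r (1 : R))))).
  by rewrite /= /GRing.scale/= mulr1 expr1.
have dj : is_derive r 1 (fun r : R => r ^+ j) (j%:R * r ^+ j.-1).
  have := is_deriveX j (is_derive_id r (1 : R)).
  by rewrite exprfctE => /is_derive_eq; apply; rewrite /= /GRing.scale/= mulr1.
have dE : is_derive r 1 (fun r => expR (- (b * r ^+ 2 / 4)))
    (expR (- (b * r ^+ 2 / 4)) * (- (b / 2 * r))).
  have := @is_derive1_comp _ expR (fun r => - (b / 4) * r ^+ 2) r _ _ (is_derive_expR _) (d2 (- (b / 4))).
  rewrite [in X in X -> _](_ : - (b / 4) * (2 * r) = - (b / 2 * r)); last by field.
  rewrite (_ : - (b / 4) * r ^+ 2 = - (b * r ^+ 2 / 4)); last by ring.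
  by rewrite (_ : _ \o _ = fun r => expR (- (b * r ^+ 2 / 4)))//; apply/funext => t /=; congr expR; ring.
have dF : is_derive r 1 (fun r => F (b * r ^+ 2 / 2)) (F' (b * r ^+ 2 / 2) * (b * r)).
  have := @is_derive1_comp _ F (fun r => b / 2 * r ^+ 2) r _ _ (FD _) (d2 (b / 2)).
  rewrite [in X in X -> _](_ : b / 2 * (2 * r) = b * r); last by field.
  rewrite (_ : b / 2 * r ^+ 2 = b * r ^+ 2 / 2); last by ring.
  by rewrite (_ : _ \o _ = fun r => F (b * r ^+ 2 / 2))//; apply/funext => t /=; congr F; ring.
apply: (is_derive_eq (is_deriveM dj (is_deriveM dE dF))); rewrite /= /GRing.scale/= /gauss_mono.
rewrite mulrfctE [r ^+ j.+1]exprS; ring.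
Qed.

Lemma continuous_mul (f g : R -> R) :
  continuous f -> continuous g -> continuous (fun r => f r * g r).
Proof. by move=> fc gc r; exact: (continuousM (fc r) (gc r)). Qed.

Lemma continuous_add (f g : R -> R) :
  continuous f -> continuous g -> continuous (fun r => f r + g r).
Proof. by move=> fc gc r; exact: (continuousD (fc r) (gc r)). Qed.

Lemma continuous_scale (c : R) (f : R -> R) :
  continuous f -> continuous (fun r => c * f r).
Proof. by move=> fc; apply: continuous_mul => //; move=> r; exact: cst_continuous. Qed.

Lemma continuous_gauss_mono b j F : continuous F -> continuous (gauss_mono b j F).
Proof.
move=> Fc; have d2 (c : R) : continuous (fun r => b * r ^+ 2 / c).
  apply: continuous_mul; last by move=> r; exact: cst_continuous.
  by apply: continuous_mul; [move=> r; exact: cst_continuous|exact: exprn_continuous].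
apply: continuous_mul; first exact: exprn_continuous.
apply: continuous_mul => r.
  apply: (@continuous_comp _ _ _ (fun r => - (b * r ^+ 2 / 4)) expR); last exact: continuous_expR.
  exact: (continuousN (d2 4 r)).
apply: (@continuous_comp _ _ _ (fun r => b * r ^+ 2 / 2) F); first exact: d2.
exact: Fc.
Qed.

Variables (a b : R) (k : nat).
Hypothesis b0 : 0 < b.

Let M := kummer a k.
Let M' := kummer' a k.
Let M'' := kummer'' a k.

Definition regsol := gauss_mono b k M.

Let L s := b * M' s - b / 2 * M s.
Let L' s := b * M'' s - b / 2 * M' s.

Definition regsol' r := k%:R * gauss_mono b k.-1 M r + gauss_mono b k.+1 L r.

Definition regsol'' r :=
  k%:R * (k.-1%:R * gauss_mono b k.-2 M r + gauss_mono b k.-1.+1 L r)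
  + (k.+1%:R * gauss_mono b k L r
     + gauss_mono b k.+2 (fun s => b * L' s - b / 2 * L s) r).

Let L_derive (s : R) : is_derive s 1 L (L' s).
Proof.
have := is_deriveB (is_deriveZ b (is_derive_kummer' a k s))
   (is_deriveZ (b / 2) (is_derive_kummer a k s)).
by [].
Qed.

Lemma is_derive_regsol r : is_derive r 1 regsol (regsol' r).
Proof. exact/is_derive_gauss_mono/is_derive_kummer. Qed.

Lemma is_derive_regsol' r : is_derive r 1 regsol' (regsol'' r).
Proof.
have := is_deriveD (is_deriveZ k%:R (@is_derive_gauss_mono b k.-1 M M' r (is_derive_kummer a k)))
  (@is_derive_gauss_mono b k.+1 L L' r L_derive).
by [].
Qed.

Let cM : continuous M.
Proof. by move=> s; apply: is_derive_continuous; exact: is_derive_kummer. Qed.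
Let cM' : continuous M'.
Proof. by move=> s; apply: is_derive_continuous; exact: is_derive_kummer'. Qed.
Let cM'' : continuous M''.
Proof.
move=> s; apply: is_derive_continuous; apply: is_derive_psum.
exact/entire_diffs/entire_diffs/entire_kummer_coef.
Qed.
Let cL : continuous L.
Proof. by move=> s; apply: is_derive_continuous; exact: L_derive. Qed.
Let cL' : continuous L'.
Proof.
rewrite /L'; under eq_fun do rewrite -mulNr.
by apply: continuous_add; apply: continuous_scale.
Qed.

Lemma continuous_regsol : continuous regsol.
Proof. exact: continuous_gauss_mono. Qed.

Lemma continuous_regsol' : continuous regsol'.
Proof. by move=> r; apply: is_derive_continuous; exact: is_derive_regsol'. Qed.

Lemma continuous_regsol'' : continuous regsol''.
Proof.
have cLL : continuous (fun s => b * L' s - b / 2 * L s).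
  under eq_fun do rewrite -mulNr.
  by apply: continuous_add; apply: continuous_scale.
apply: continuous_add.
  by apply/continuous_scale/continuous_add; [apply/continuous_scale|]; exact: continuous_gauss_mono.
apply: continuous_add; first by apply/continuous_scale; exact: continuous_gauss_mono.
exact: continuous_gauss_mono.
Qed.

Lemma regsol_ode (m x r : R) : m ^+ 2 = k%:R ^+ 2 -> r != 0 ->
  a = 2^-1 + (k%:R - m) / 2 - x / (2 * b) ->
  - regsol'' r - r^-1 * regsol' r + (m / r - b * r / 2) ^+ 2 * regsol r
    = x * regsol r.
Proof.
move=> mk r0 aE; have bn0 : b != 0 by rewrite gt_eqF.
(* Truncated predecessors are traded for divisions by r; where truncation occurs, for k = 0 or k =
   1, the prefactor is zero. *)
have k1 F : k%:R * gauss_mono b k.-1 F r = k%:R * gauss_mono b k F r / r.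
  rewrite /gauss_mono; case: k => [|i]; first by rewrite !mul0r.
  by rewrite [i.+1.-1]/= [in RHS]exprS; field.
have k2 F : k%:R * (k.-1%:R * gauss_mono b k.-2 F r)
    = k%:R * (k%:R - 1) * gauss_mono b k F r / r ^+ 2.
  rewrite /gauss_mono; case: k => [|[|i]]; [by rewrite !mul0r|by rewrite /= mul0r subrr !mulr0 !mul0r|].
  by rewrite [i.+2.-2]/= [i.+2.-1]/= [in RHS]exprS [in RHS]exprS -[i.+2%:R]natr1 addrK; field.
have k3 F : k%:R * gauss_mono b k.-1.+1 F r = k%:R * gauss_mono b k F r.
  by case: k => [|i]; rewrite ?mul0r.
rewrite /regsol'' /regsol' /regsol mulrDr k1 k2 k3.
have V : (m / r - b * r / 2) ^+ 2 = k%:R ^+ 2 / r ^+ 2 - m * b + b ^+ 2 * r ^+ 2 / 4.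
  by rewrite -mk; field.
have ode : M'' (b * r ^+ 2 / 2) = 2 * (a * M (b * r ^+ 2 / 2)
     - (k%:R + 1 - b * r ^+ 2 / 2) * M' (b * r ^+ 2 / 2)) / (b * r ^+ 2).
  have := kummer_ode a k (b * r ^+ 2 / 2); rewrite -[k.+1%:R]natr1 -/(M _) -/(M' _) -/(M'' _) => <-.
  by field; rewrite r0 bn0.
rewrite /gauss_mono /L' /L ode V aE ![in r ^+ _.+1]exprS -[k.+1%:R]natr1.
by field; rewrite r0 bn0.
Qed.

Lemma regsol'1 : regsol' 1 = expR (- (b / 4)) * neumann_fun a k (b / 2).
Proof.
rewrite /regsol' /gauss_mono !expr1n !mul1r mulr1 /L /neumann_fun -/M -/M'.
by field.
Qed.

Lemma regsol_near0 : exists e, [/\ 0 < e, e < 1 &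
  forall r, 0 < r -> r <= e -> 2^-1 * r ^+ k <= regsol r <= 2 * r ^+ k].
Proof.
have c0 := @continuous_gauss_mono b 0 M cM 0.
have v0 : gauss_mono b 0 M 0 = 1.
  by rewrite /gauss_mono expr0 mul1r expr0n/= !(mulr0, mul0r) oppr0 expR0 mul1r /M kummer0.
have /cvgrPdist_le /(_ 2^-1) : gauss_mono b 0 M r @[r --> (0 : R)] --> (1 : R) by rewrite -[in X in _ --> X]v0.
rewrite invr_gt0 ltr0Sn => /(_ isT) /nbhs_ballP[e /= e0 eP].
exists (Num.min (e / 2) 2^-1); split.
- by rewrite lt_min; apply/andP; split; lra.
- by rewrite gt_min; apply/orP; right; lra.
move=> r r0; rewrite le_min => /andP[re _].
have br : ball (0 : R) e r by rewrite /ball/= sub0r normrN gtr0_norm//; lra.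
have h := eP r br; have -> : regsol r = r ^+ k * gauss_mono b 0 M r.
  by rewrite /regsol /gauss_mono expr0 mul1r.
move: h; rewrite /= ler_distl => /andP[h1 h2].
have rk : 0 <= r ^+ k by rewrite exprn_ge0// ltW.
by apply/andP; split; [rewrite mulrC|rewrite [leRHS]mulrC]; apply: ler_wpM2l => //; lra.
Qed.

Lemma regsol_bound : (0 < k)%N -> exists C, 0 < C /\
  forall r, 0 <= r <= 1 -> `|regsol r| <= C * r /\ `|regsol' r| <= C.
Proof.
move=> k0.
have [C1 [C10 C1P]] := continuous_bounded01 (@continuous_gauss_mono b k.-1 M cM).
have [C2 [C20 C2P]] := continuous_bounded01 continuous_regsol'.
exists (C1 + C2); split; first exact: addr_gt0.
move=> r r01; split.
  have -> : regsol r = r * gauss_mono b k.-1 M r.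
    by rewrite /gauss_mono mulrA -exprS prednK.
  have /andP[r0 _] := r01.
  rewrite normrM mulrC (ger0_norm r0) ler_wpM2r// (le_trans (C1P _ r01))// lerDl; exact: ltW.
by rewrite (le_trans (C2P _ r01))// lerDr; exact: ltW.
Qed.

End RegularSolution.

(** * Uniqueness of the regular solution *)

Section LinearODE.
Variable R : realType.
Implicit Types (f g : R -> R) (r s t C : R).

Lemma sqr_normr (x : R) : `|x| ^+ 2 = x ^+ 2.
Proof. by rewrite real_normK// num_real. Qed.

(** The energy E = g^2 + g1^2 satisfies E' <= (1 + 3 C) E, so E(r) e^{-(1 + 3 C) r} is
    nonincreasing; it is nonnegative and starts at 0. *)
Lemma gronwall_zero (g g1 g2 p q : R -> R) s t C : s <= t ->
  (forall r, s <= r <= t -> is_derive r 1 g (g1 r)) ->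
  (forall r, s <= r <= t -> is_derive r 1 g1 (g2 r)) ->
  (forall r, s <= r <= t -> g2 r = p r * g r + q r * g1 r) ->
  (forall r, s <= r <= t -> `|p r| <= C /\ `|q r| <= C) ->
  g s = 0 -> g1 s = 0 -> g t = 0 /\ g1 t = 0.
Proof.
move=> st gd g1d g2E pq gs g1s; pose D := 1 + 3 * C.
pose E r := g r ^+ 2 + g1 r ^+ 2.
have Ed r : s <= r <= t -> is_derive r 1 E (2 * g r * g1 r + 2 * g1 r * g2 r).
  move=> rst; have gd' := gd _ rst; have g1d' := g1d _ rst.
  apply: (is_derive_eq (is_deriveD (is_deriveX 2 gd') (is_deriveX 2 g1d'))).
  by rewrite /GRing.scale/= !expr1.
have ed r : is_derive r 1 (fun r => expR (- D * r)) (expR (- D * r) * - D).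
  have := @is_derive1_comp _ expR (fun r => - D * r) r _ (- D) (is_derive_expR _).
  apply; apply: (is_derive_eq (is_deriveZ (- D) (is_derive_id r (1 : R)))).
  by rewrite /GRing.scale/= mulr1.
have : - (E s * expR (- D * s)) <= - (E t * expR (- D * t)).
  apply: (@is_derive_ndecr _ (fun r => - (E r * expR (- D * r)))
    (fun r => - (E r * (expR (- D * r) * - D) + expR (- D * r) * (2 * g r * g1 r + 2 * g1 r * g2 r)))).
  - exact: st.
  - by move=> r rst; have := is_deriveN (is_deriveM (Ed r rst) (ed r)).
  move=> r rst; have [pC qC] := pq _ rst; rewrite (g2E _ rst).
  rewrite [leRHS](_ : _ = expR (- D * r) * (D * E r - (2 * g r * g1 r + 2 * g1 r * (p r * g r + q r * g1 r)))); last by ring.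
  rewrite mulr_ge0 ?expR_ge0// subr_ge0 /D.
  have C0 : 0 <= C by rewrite (le_trans _ pC).
  have h1 : 2 * g r * g1 r <= E r.
    by rewrite /E -subr_ge0; have := sqr_ge0 (g r - g1 r); lra.
  have h2 : p r * (2 * g r * g1 r) <= C * E r.
    apply: le_trans (ler_norm _) _; rewrite normrM ler_pM// ler_norml; apply/andP; split => //.
    by rewrite /E; have := sqr_ge0 (g r + g1 r); lra.
  have h3 : q r * g1 r ^+ 2 <= C * E r.
    apply: (@le_trans _ _ (C * g1 r ^+ 2)).
      by rewrite ler_wpM2r ?sqr_ge0// (le_trans (ler_norm _)).
    by rewrite ler_wpM2l// lerDr sqr_ge0.
  lra.
rewrite /E gs g1s !expr0n/= addr0 mul0r oppr0 oppr_ge0.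
rewrite pmulr_lle0 ?expR_gt0// => h.
have := sqr_ge0 (g t); have := sqr_ge0 (g1 t) => a1 a2.
have e1 : g t ^+ 2 = 0 by lra.
have e2 : g1 t ^+ 2 = 0 by lra.
by split; apply/eqP; rewrite -sqrf_eq0 ?e1 ?e2.
Qed.

End LinearODE.

(** * The Wronskian with the regular solution *)

Section Uniqueness.
Variable R : realType.

Local Notation mu := (@lebesgue_measure R).
Local Notation I01 := (`]0, 1[%classic : set R).
Variables (m b x : R) (k : nat) (f f1 f2 : R -> R).
Hypotheses (b0 : 0 < b) (mk : m ^+ 2 = k%:R ^+ 2).
Hypothesis fd : forall r : R, 0 < r < 1 -> is_derive r 1 f (f1 r).
Hypothesis f1d : forall r : R, 0 < r < 1 -> is_derive r 1 f1 (f2 r).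
Let V (r : R) := (m / r - b * r / 2) ^+ 2.
Hypothesis f_ode : forall r : R, 0 < r < 1 -> - f2 r - r^-1 * f1 r + V r * f r = x * f r.
Let a := 2^-1 + (k%:R - m) / 2 - x / (2 * b).
Let v := regsol a b k.
Let v1 := regsol' a b k.
Let v2 := regsol'' a b k.
Let vd (r : R) : is_derive r 1 v (v1 r). Proof. exact: is_derive_regsol. Qed.
Let v1d (r : R) : is_derive r 1 v1 (v2 r). Proof. exact: is_derive_regsol'. Qed.
Let v_ode (r : R) : 0 < r < 1 -> - v2 r - r^-1 * v1 r + V r * v r = x * v r.
Proof. by move=> /andP[r0 _]; apply: regsol_ode => //; rewrite gt_eqF. Qed.

(** The weight r matches the divergence form -(r u')' / r of the operator and makes the Wronskian of
    two solutions constant. *)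
Let W (r : R) := r * (f r * v1 r - f1 r * v r).
Let w := W 2^-1.

Let Wd (r : R) : 0 < r < 1 -> is_derive r 1 W 0.
Proof.
move=> r01; have fd' := fd r01; have f1d' := f1d r01; have vd' := vd r; have v1d' := v1d r.
apply: (is_derive_eq (is_deriveM (is_derive_id r (1 : R)) (is_deriveB (is_deriveM fd' v1d') (is_deriveM f1d' vd')))).
have /andP[r0 _] := r01; have rn0 : r != 0 by rewrite gt_eqF.
have ef : f2 r = - (r^-1 * f1 r) + V r * f r - x * f r by have := f_ode r01; lra.
have ev : v2 r = - (r^-1 * v1 r) + V r * v r - x * v r by have := v_ode r01; lra.
rewrite /= /GRing.scale/= ef ev; move: (V r) => Vr.
by rewrite !fctE /=; field.
Qed.

Let Wcst (r : R) : 0 < r < 1 -> W r = w.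
Proof.
move=> /andP[r0 r1]; rewrite /w.
have [h|h] := leP r 2^-1.
  apply/esym; apply: (@is_derive0_eq _ W) => // u /andP[u1 u2].
  by apply: Wd; apply/andP; split; lra.
apply: (@is_derive0_eq _ W); first exact: ltW.
by move=> u /andP[u1 u2]; apply: Wd; apply/andP; split; lra.
Qed.

(* Near 0 the regular solution does not vanish and f / v is constant; beyond, the
   difference f - c v is zero by Gronwall's inequality. *)
Lemma eigenfunction_multiple : w = 0 ->
  exists c, forall r, 0 < r < 1 -> f r = c * v r /\ f1 r = c * v1 r.
Proof.
move=> w0; have [e [e0 e1 vP]] := regsol_near0 a b k.
have vpos r : 0 < r -> r <= e -> 0 < v r.
  move=> r0 re; have /andP[h _] := vP _ r0 re; apply: lt_le_trans h.
  by rewrite mulr_gt0// ?exprn_gt0// invr_gt0.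
pose c := f e / v e.
have small r : 0 < r -> r <= e -> f r = c * v r /\ f1 r = c * v1 r.
  move=> r0 re; have r01 : 0 < r < 1 by rewrite r0 (le_lt_trans re).
  have vr := vpos _ r0 re.
  have fr : f r = c * v r.
    suff : f e / v e = f r / v r by rewrite /c => ->; rewrite divfK// gt_eqF.
    apply: (@is_derive0_eq _ (fun r => f r / v r) r e) => // u /andP[u1 u2].
    have u0 : 0 < u by rewrite (lt_le_trans r0).
    have u01 : 0 < u < 1 by rewrite u0 (le_lt_trans u2).
    have fd' := fd u01; have vd' := vd u; have vu := vpos _ u0 u2.
    apply: (is_derive_eq (is_deriveM fd' (is_deriveV (negbT (gt_eqF vu)) vd'))).
    have := Wcst u01; rewrite w0 /W => /eqP; rewrite mulf_eq0 gt_eqF//= subr_eq0 => /eqP fv.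
    have -> : f1 u = f u * v1 u / v u by rewrite fv mulfK// gt_eqF.
    by rewrite /GRing.scale/=; field; rewrite gt_eqF.
  split => //; have := Wcst r01; rewrite w0 /W fr => /eqP.
  rewrite mulf_eq0 gt_eqF//= subr_eq0 mulrAC => /eqP h.
  by apply: (mulIf (negbT (gt_eqF vr))); rewrite h.
exists c => r r01; have /andP[r0 r1] := r01.
have [re|re] := leP r e; first exact: small.
have [fe f1e] := small e e0 (lexx _).
(* Bounds both coefficients V - x and -1/u of the equation on [e, r], away from the singularity at
   0. *)
pose C := e^-1 + (`|m| / e + b) ^+ 2 + `|x|.
have [|||||||g0 g10] := @gronwall_zero _ (fun r => f r - c * v r) (fun r => f1 r - c * v1 r)
   (fun r => f2 r - c * v2 r) (fun r => V r - x) (fun r => - r^-1) e r C.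
- exact: ltW.
- move=> u /andP[u1 u2]; have u01 : 0 < u < 1 by apply/andP; split; lra.
  have fd' := fd u01; have := is_deriveB fd' (is_deriveZ c (vd u)); exact.
- move=> u /andP[u1 u2]; have u01 : 0 < u < 1 by apply/andP; split; lra.
  have f1d' := f1d u01; have := is_deriveB f1d' (is_deriveZ c (v1d u)); exact.
- move=> u /andP[u1 u2]; have u01 : 0 < u < 1 by apply/andP; split; lra.
  have := f_ode u01; have := v_ode u01 => ev ef.
  have -> : f2 u = - (u^-1 * f1 u) + V u * f u - x * f u by lra.
  have -> : v2 u = - (u^-1 * v1 u) + V u * v u - x * v u by lra.
  by ring.
- move=> u /andP[u1 u2]; have u0 : 0 < u by lra.
  have ue : u^-1 <= e^-1 by rewrite lef_pV2.
  have e'0 : 0 <= e^-1 by rewrite invr_ge0 ltW.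
  have Vu : `|V u| <= (`|m| / e + b) ^+ 2.
    rewrite /V normrX lerXn2r ?nnegrE ?addr_ge0 ?mulr_ge0// ?(ltW b0)//.
    rewrite (le_trans (ler_normB _ _))// lerD//.
      by rewrite normrM ler_wpM2l// ger0_norm// invr_ge0 ltW.
    rewrite ger0_norm; last by rewrite !mulr_ge0// ltW.
    by rewrite -mulrA ler_piMr ?(ltW b0)//; lra.
  split; last first.
    rewrite normrN ger0_norm; last by rewrite invr_ge0 ltW.
    by rewrite /C -addrA (le_trans ue)// lerDl addr_ge0// sqr_ge0.
  rewrite (le_trans (ler_normB _ _))// /C -addrA (le_trans (lerD Vu (lexx _)))//.
  by rewrite lerDr.
- by rewrite fe subrr.
- by rewrite f1e subrr.
by move/eqP: g0; move/eqP: g10; rewrite !subr_eq0 => /eqP -> /eqP ->.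
Qed.

(* |w| <= C r^2 (|f / r| + |f'|), so h >= c r^{-3} with c > 0 unless w = 0. *)
Lemma wronskian0_integrable (h : R -> R) : (0 < k)%N ->
  mu.-integrable I01 (EFin \o h) ->
  (forall r, 0 < r < 1 -> ((f r / r) ^+ 2 + f1 r ^+ 2) * r <= h r) -> w = 0.
Proof.
move=> k0 hi fh; apply/eqP; apply: contraT => w0.
have [C [C0 CP]] := regsol_bound a b k0.
pose H := \int[mu]_(r in I01) h r.
have h0 r : 0 < r < 1 -> 0 <= h r.
  move=> r01; apply: le_trans (fh _ r01); have /andP[r0 _] := r01.
  by rewrite mulr_ge0 ?(ltW r0)// addr_ge0 ?sqr_ge0.
have H0 : 0 <= H by apply: Rintegral_ge0 => r; rewrite /= in_itv/=; exact: h0.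
have key r : 0 < r < 1 -> w ^+ 2 <= 2 * C ^+ 2 * r ^+ 3 * h r.
  move=> r01; have /andP[r0 r1] := r01; rewrite -(Wcst r01) /W.
  have [vb v1b] : `|v r| <= C * r /\ `|v1 r| <= C by apply: CP; rewrite !ltW.
  rewrite -sqr_normr.
  have n1 : `|r * (f r * v1 r - f1 r * v r)| <= C * r ^+ 2 * (`|f r / r| + `|f1 r|).
    rewrite normrM (gtr0_norm r0) [leRHS](_ : _ = r * (C * r * (`|f r / r| + `|f1 r|))); last by ring.
    rewrite ler_wpM2l ?(ltW r0)// (le_trans (ler_normB _ _))// [leRHS]mulrDr lerD//.
      rewrite normrM normrM normfV (gtr0_norm r0) [leRHS](_ : _ = `|f r| * C).
        by rewrite ler_wpM2l.
      by field; rewrite gt_eqF.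
    by rewrite normrM mulrC ler_wpM2r.
  apply: (@le_trans _ _ ((C * r ^+ 2 * (`|f r / r| + `|f1 r|)) ^+ 2)).
    by rewrite lerXn2r ?nnegrE// (le_trans _ n1).
  apply: (@le_trans _ _ (2 * C ^+ 2 * r ^+ 3 * (((f r / r) ^+ 2 + f1 r ^+ 2) * r))); last first.
    by rewrite ler_wpM2l ?fh// !mulr_ge0 ?exprn_ge0 ?ltW.
  rewrite -(sqr_normr (f r / r)) -(sqr_normr (f1 r)).
  move: `|f r / r| `|f1 r| => A B.
  rewrite -subr_ge0 [leRHS](_ : _ = C ^+ 2 * r ^+ 4 * (A - B) ^+ 2); last by ring.
  apply: mulr_ge0; last exact: sqr_ge0.
  by apply: mulr_ge0; [exact: sqr_ge0|rewrite exprn_ge0// ltW].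
have w2 : 0 < w ^+ 2 by rewrite exprn_even_gt0.
(* On [s, 2 s] one has r^3 <= 8 s^3, hence h >= c / s^3 and an integral of at least c / s^2. The
   number s below keeps this interval inside (0, 1) and makes c / s^2 exceed the total integral
   [H]. *)
pose c := w ^+ 2 / (16 * C ^+ 2).
have c0 : 0 < c by rewrite divr_gt0// mulr_gt0// exprn_gt0.
pose s := Num.min 4^-1 (c / (H + 1)).
have s0 : 0 < s by rewrite lt_min invr_gt0 ltr0Sn/= divr_gt0// ltr_wpDl.
have s4 : s <= 4^-1 by rewrite ge_min lexx.
have sc : s * (H + 1) <= c by rewrite -ler_pdivlMr ?ltr_wpDl// ge_min lexx orbT.
have sub : `[s, 2 * s] `<=` I01.
  by move=> r /=; rewrite !in_itv/= => /andP[r1 r2]; apply/andP; split; lra.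
have hi' : mu.-integrable `[s, 2 * s] (EFin \o h) by apply: integrableS hi.
have : c / s ^+ 3 * s <= H.
  have -> : c / s ^+ 3 * s = \int[mu]_(r in `[s, 2 * s]) (c / s ^+ 3).
    have mE : mu `[s, 2 * s]%classic = s%:E.
      rewrite lebesgue_measure_itv/= lte_fin ifT; last by lra.
      by rewrite -EFinD; congr (_%:E); ring.
    by rewrite Rintegral_cst// [X in fine X]mE.
  apply: (@le_trans _ _ (\int[mu]_(r in `[s, 2 * s]) h r)).
    apply: le_Rintegral => //.
      apply: continuous_compact_integrable; first exact: segment_compact.
      by apply: continuous_subspaceT => ?; exact: cst_continuous.
    move=> r rs; have r01 := sub _ rs; move: rs r01; rewrite /= !in_itv/= => /andP[r1 r2] r01.
    have := key _ r01.
    have r3 : r ^+ 3 <= 8 * s ^+ 3.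
      by rewrite [leRHS](_ : _ = (2 * s) ^+ 3); [rewrite lerXn2r ?nnegrE//; lra|ring].
    move=> kr; have {}kr : w ^+ 2 <= 2 * C ^+ 2 * (8 * s ^+ 3) * h r.
      apply: le_trans kr _; rewrite ler_wpM2r ?h0// ler_wpM2l// mulr_ge0// exprn_ge0// ltW//.
    rewrite /c ler_pdivrMr ?exprn_gt0// ler_pdivrMr ?mulr_gt0 ?exprn_gt0//.
    by apply: le_trans kr _; rewrite le_eqVlt; apply/orP; left; apply/eqP; ring.
  rewrite /H /Rintegral fine_le//.
  - exact: integrable_fin_num.
  - exact: integrable_fin_num.
  apply: ge0_subset_integral => //.
  by have /integrableP[] := hi.
rewrite [leLHS](_ : _ = c / s / s); last by field; rewrite gt_eqF.
rewrite ler_pdivrMr// ler_pdivrMr// => h1.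
have : H * s * s <= H * s / 4.
  by rewrite ler_wpM2l ?mulr_ge0 ?(ltW s0).
have : 0 <= H * s by rewrite mulr_ge0 ?(ltW s0).
lra.
Qed.

(* (f / v)' = - w / (r v^2), so |f| grows at least like |w ln r| unless w = 0. *)
Lemma wronskian0_ln : k = 0%N ->
  (forall d : R, 0 < d -> \forall r \near (0 : R)^'+, `|f r| <= d * `|ln r|) -> w = 0.
Proof.
move=> k0 fln; apply/eqP; apply: contraT => w0.
have w1 : 0 < `|w| by rewrite normr_gt0.
have [e [e0 e1 vP]] := regsol_near0 a b k.
have vb (r : R) : 0 < r -> r <= e -> 2^-1 <= v r /\ v r <= 2.
  move=> r0 re; have rk : r ^+ k = 1 by rewrite k0 expr0.
  by have := vP _ r0 re; rewrite rk !mulr1 => /andP[].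
(* Near 0 one has v <= 2, so the derivative w^2 / (r v^2) of the first term is at least w^2 / (4 r),
   and [psi] is nondecreasing. *)
pose psi r := - (w * (f r / v r)) - w ^+ 2 / 4 * ln r.
pose A := psi e.
have psiA r : 0 < r -> r <= e -> psi r <= A.
  move=> r0 re.
  pose dpsi (u : R) := w ^+ 2 / (u * v u ^+ 2) - w ^+ 2 / (4 * u).
  have psid (u : R) : r <= u <= e -> is_derive u 1 psi (dpsi u).
    move=> /andP[u1 u2]; have u0 : 0 < u by rewrite (lt_le_trans r0).
    have u01 : 0 < u < 1 by rewrite u0 (le_lt_trans u2).
    have [vu _] := vb _ u0 u2; have vu0 : v u != 0 by rewrite gt_eqF// (lt_le_trans _ vu).
    have un0 : u != 0 by rewrite gt_eqF.
    have fd' := fd u01; have vd' := vd u.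
    have dd := is_deriveM fd' (is_deriveV vu0 vd').
    have dl := is_derive1_ln u0.
    apply: (is_derive_eq (is_deriveB (is_deriveN (is_deriveZ w dd)) (is_deriveZ (w ^+ 2 / 4) dl))).
    have -> : dpsi u = w * (f u * v1 u - f1 u * v u) / v u ^+ 2 - w ^+ 2 / (4 * u).
      rewrite /dpsi; congr (_ - _).
      have -> : w ^+ 2 = w * (u * (f u * v1 u - f1 u * v u)) by rewrite -[_ * (_ - _)]/(W u) Wcst.
      by field; rewrite vu0 un0.
    by rewrite /GRing.scale/=; field; rewrite vu0 un0.
  apply: (is_derive_ndecr re psid) => u /andP[u1 u2].
  have u0 : 0 < u by rewrite (lt_le_trans r0).
  have [vu vu'] := vb _ u0 u2.
  have vu0 : 0 < v u by rewrite (lt_le_trans _ vu).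
  rewrite subr_ge0; apply: ler_wpM2l; first exact: sqr_ge0.
  have p1 : 0 < u * v u ^+ 2 by exact: (mulr_gt0 u0 (exprn_gt0 2 vu0)).
  have p2 : 0 < 4 * u by lra.
  rewrite lef_pV2 ?posrE//.
  rewrite mulrC; apply: ler_wpM2r; first exact: ltW.
  rewrite [leRHS](_ : _ = 2 ^+ 2); last by ring.
  by rewrite lerXn2r ?nnegrE// ltW.
(* As 1 / v <= 2, the term w f / v can absorb only half of the growth (w^2 / 4) |ln r|; the other
   half exceeds |A| at such an r. *)
have [r [r0 re rs rl]] : exists r, [/\ 0 < r, r <= e, `|f r| <= `|w| / 16 * `|ln r| & `|A| + 1 <= w ^+ 2 / 8 * - ln r].
  near ((0 : R)^'+) => r; exists r; split.
  - by near: r; exact: nbhs_right_gt.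
  - by near: r; exact: nbhs_right_le.
  - by near: r; apply: fln; rewrite divr_gt0.
  have r0 : 0 < r by near: r; exact: nbhs_right_gt.
  rewrite mulrC -ler_pdivrMr; last by rewrite divr_gt0// exprn_even_gt0.
  rewrite lerNr -ler_expR lnK ?posrE//.
  by near: r; apply: nbhs_right_le; exact: expR_gt0.
have lr : ln r <= 0 by rewrite ln_le0// (le_trans re)// ltW.
have [vr vr'] := vb _ r0 re.
have vr0 : 0 < v r by rewrite (lt_le_trans _ vr).
have := psiA _ r0 re; rewrite /psi => pA.
have : w * (f r / v r) <= w ^+ 2 / 8 * - ln r.
  rewrite (le_trans (ler_norm _))// normrM (normrM (f r)) normfV (gtr0_norm vr0).
  apply: (@le_trans _ _ (`|w| * (`|w| / 16 * `|ln r| * 2))).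
    rewrite ler_wpM2l// ler_pM ?invr_ge0 ?(ltW vr0)//.
    by rewrite -[leRHS]invrK lef_pV2 ?posrE.
  rewrite (ler0_norm lr) -(sqr_normr w); lra.
have : A <= `|A| by rewrite ler_norm.
lra.
Unshelve. all: by end_near. Qed.

End Uniqueness.

(** * Eigenspaces *)

Section ComplexParts.
Local Open Scope complex_scope.
Variable R : realType.
Local Notation mu := (@lebesgue_measure R).
Local Notation I01 := (`]0, 1[%classic : set R).
Implicit Types (u w : R -> R[i]) (f g : R -> R) (r t : R) (z : R[i]).

Lemma ReD z1 z2 : complex.Re (z1 + z2 : R[i]) = complex.Re z1 + complex.Re z2.
Proof. by case: z1 => ? ?; case: z2. Qed.
Lemma ImD z1 z2 : complex.Im (z1 + z2 : R[i]) = complex.Im z1 + complex.Im z2.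
Proof. by case: z1 => ? ?; case: z2. Qed.
Lemma ReN z : complex.Re (- z) = - complex.Re z.
Proof. by case: z. Qed.
Lemma ImN z : complex.Im (- z) = - complex.Im z.
Proof. by case: z. Qed.
Lemma Re_realM t z : complex.Re (t%:C * z) = t * complex.Re z.
Proof. by case: z => p q /=; rewrite mul0r subr0. Qed.
Lemma Im_realM t z : complex.Im (t%:C * z) = t * complex.Im z.
Proof. by case: z => p q /=; rewrite mul0r addr0. Qed.

Lemma realC_inv t : (t%:C)^-1 = (t^-1)%:C :> R[i].
Proof. by rewrite fmorphV. Qed.

Lemma normc_sqr z : Normc.normc z ^+ 2 = complex.Re z ^+ 2 + complex.Im z ^+ 2.
Proof. by case: z => p q /=; rewrite sqr_sqrtr// addr_ge0 ?sqr_ge0. Qed.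

Lemma normc_real t : Normc.normc (t%:C : R[i]) = `|t|.
Proof. by rewrite /= expr0n/= addr0 sqrtr_sqr. Qed.

Lemma Re_le_normc z : `|complex.Re z| <= Normc.normc z.
Proof.
case: z => p q /=; rewrite -sqrtr_sqr ler_wsqrtr// lerDl; exact: sqr_ge0.
Qed.

Lemma Im_le_normc z : `|complex.Im z| <= Normc.normc z.
Proof.
case: z => p q /=; rewrite -sqrtr_sqr ler_wsqrtr// lerDr; exact: sqr_ge0.
Qed.

Lemma eq_L2 u w : (forall r, 0 < r < 1 -> u r = w r) -> L2 u -> L2 w.
Proof.
move=> uw [m1 m2 i]; split.
- by apply: eq_measurable_fun m1 => r; rewrite inE/= in_itv/= => /uw ->.
- by apply: eq_measurable_fun m2 => r; rewrite inE/= in_itv/= => /uw ->.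
- by apply: eq_integrable i => // r; rewrite inE/= in_itv/= => /uw ->.
Qed.

Lemma L2_continuous f : continuous f -> L2 (fun r => (f r)%:C).
Proof.
move=> fc; split.
- by apply: measurable_funTS; exact: measurable_realfun.continuous_measurable_fun.
- exact: measurable_cst.
have c2 : continuous (fun r => `|f r| ^+ 2 * r).
  under eq_fun do rewrite sqr_normr expr2.
  apply: continuous_mul; first exact: continuous_mul.
  by move=> r; exact: cvg_id.
apply: (@integrableS _ _ _ mu `[0, 1]) => //.
  by apply: subset_itv; rewrite bnd_simp.
rewrite (_ : (fun r => _) = EFin \o (fun r => `|f r| ^+ 2 * r)); last first.
  by apply/funext => r; rewrite normc_real.
apply: continuous_compact_integrable; first exact: segment_compact.
exact: continuous_subspaceT.
Qed.

Lemma ae_exists (P : R -> Prop) (e : R) : 0 < e -> e <= 1 ->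
  {ae mu, forall r, I01 r -> P r} -> exists r, [/\ 0 < r, r < e & P r].
Proof.
move=> e0 e1 [N [mN N0 sN]]; apply: contrapT => nP.
have : (mu (`]0%R, e[%classic : set R) <= mu N)%E.
  apply: le_measure; rewrite ?inE//.
  move=> r /=; rewrite in_itv/= => /andP[r0 re]; apply: sN => /= rP.
  apply: nP; exists r; split => //; apply: rP.
  by rewrite /= in_itv/= r0 (lt_le_trans re).
by rewrite N0 lebesgue_measure_itv/= lte_fin e0 -EFinD subr0 lee_fin leNgt e0.
Qed.

End ComplexParts.

Section Eigenspace.
Local Open Scope complex_scope.
Variable R : realType.
Local Notation mu := (@lebesgue_measure R).
Local Notation I01 := (`]0, 1[%classic : set R).
Variables (m : int) (b x : R).
Hypothesis b0 : 0 < b.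
Let k := `|m|%N.

Definition kummer_param : R := 2^-1 + (k%:R - m%:~R) / 2 - x / (2 * b).
Let a := kummer_param.
Let v := regsol a b k.
Let v1 := regsol' a b k.
Let v2 := regsol'' a b k.
Let V (r : R) : R := (m%:~R / r - b * r / 2) ^+ 2.

Let mk : m%:~R ^+ 2 = k%:R ^+ 2 :> R.
Proof.
by rewrite -[RHS]natrX -abszX -[LHS]rmorphXn /= -[in LHS](gez0_abs (sqr_ge0 m)).
Qed.

Let m0k : (m == 0) = (k == 0%N). Proof. by rewrite absz_eq0. Qed.

Let v1E : derive1 v = v1.
Proof.
apply/funext => r; have rd : is_derive r 1 v (v1 r) by exact: is_derive_regsol.
by rewrite derive1E derive_val.
Qed.

Let v2E : derive1 v1 = v2.
Proof.
apply/funext => r; have rd : is_derive r 1 v1 (v2 r) by exact: is_derive_regsol'.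
by rewrite derive1E derive_val.
Qed.

Let cst0E : derive1 (fun=> 0 : R) = (fun=> 0) :> (R -> R).
Proof. by apply/funext => r; rewrite derive1_cst. Qed.

Let uC (r : R) : R[i] := (v r)%:C.

Let cderivE : cderiv uC = fun r => (v1 r)%:C.
Proof. by apply/funext => r; rewrite /cderiv/= v1E cst0E. Qed.

Let cderiv2E : cderiv (cderiv uC) = fun r => (v2 r)%:C.
Proof. by apply/funext => r; rewrite cderivE /cderiv/= v2E cst0E. Qed.

Let opHE r : 0 < r < 1 -> opH m b uC r = (x * v r)%:C.
Proof.
move=> /andP[r0 _]; rewrite /opH cderiv2E cderivE /uC.
rewrite -!rmorphM -rmorphN -rmorphB -rmorphD; congr (_%:C).
by apply: regsol_ode => //; rewrite gt_eqF.
Qed.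

Lemma eigenspace_regsol : neumann_fun a k (b / 2) = 0 -> Defs.eigenspace m b x uC.
Proof.
move=> n0; have v11 : v1 1 = 0 by rewrite /v1 regsol'1 n0 mulr0.
have cv := @continuous_regsol R a b k.
have cv1 := @continuous_regsol' R a b k.
have cv2 := @continuous_regsol'' R a b k.
have ac0 : AC_loc (fun=> 0 : R).
  apply: (@AC_loc_smooth _ _ (fun=> 0)) => r _; last exact: cst_continuous.
split; last first.
  apply: aeW => r; rewrite /= in_itv/= => r01.
  by rewrite opHE// rmorphM.
split.
- split; split => /=.
  + by apply: (@AC_loc_smooth _ _ v1) => r _; [exact: is_derive_regsol|exact: cv1].
  + exact: ac0.
  + rewrite -/v v1E.
    by apply: (@AC_loc_smooth _ _ v2) => r _; [exact: is_derive_regsol'|exact: cv2].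
  + by rewrite cst0E; exact: ac0.
- exact: L2_continuous.
- apply: (@eq_L2 _ (fun r => (x * v r)%:C)) => [r /opHE ->//|].
  by apply: L2_continuous; exact: continuous_scale.
- rewrite cderivE; under eq_fun do rewrite normc_real.
  have : `|v1 r| @[r --> (1:R)^'-] --> `|v1 1|.
    by apply: cvg_norm; apply: cvg_at_left_filter; exact: cv1.
  by rewrite v11 normr0.
case: ifPn => [m0|/negPn/eqP m0].
  have k0 : (0 < k)%N by rewrite lt0n -m0k.
  split; last by rewrite cderivE; exact: L2_continuous.
  apply: (@eq_L2 _ (fun r => (gauss_mono b k.-1 (kummer a k) r)%:C)) => [r /andP[r0 _]|].
    rewrite /uC realC_inv -rmorphM; congr (_%:C).
    have rk : r ^+ k = r * r ^+ k.-1 by rewrite -exprS prednK.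
    by rewrite /v /regsol /gauss_mono rk; field; rewrite gt_eqF.
  apply: L2_continuous; apply: continuous_gauss_mono => s.
  by apply: is_derive_continuous; exact: is_derive_kummer.
have [C [C0 CP]] := continuous_bounded01 cv.
apply/cvgrPdist_le => d d0; near=> r.
have r0 : 0 < r by near: r; exact: nbhs_right_gt.
have r1 : r < 1 by near: r; exact: nbhs_right_lt.
have rs : r <= expR (- (C / d)) by near: r; apply: nbhs_right_le; exact: expR_gt0.
have lr : C / d <= - ln r by rewrite lerNr -ler_expR lnK.
have lp : 0 < - ln r by apply: lt_le_trans lr; rewrite divr_gt0.
have ln0 : ln r < 0 by rewrite -oppr_gt0.
rewrite sub0r normrN realC_inv -rmorphM normc_real normr_id.
rewrite (normrM (v r)) normfV (ltr0_norm ln0) ler_pdivrMr//.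
apply: (@le_trans _ _ C); first by apply: CP; rewrite !ltW.
by rewrite mulrC -ler_pdivrMr.
Unshelve. all: by end_near. Qed.

(** The coefficients are real, so real and imaginary parts can be treated separately. The equation
    expresses f'' almost everywhere through continuous functions, hence f is a classical solution;
    the last two hypotheses exclude the singular solution at 0 for k > 0 and k = 0. *)
Let real_eigenfunction (f : R -> R) : AC_loc f -> AC_loc (derive1 f) ->
  {ae mu, forall r, I01 r ->
    - derive1 (derive1 f) r - r^-1 * derive1 f r + V r * f r = x * f r} ->
  ((0 < k)%N -> exists2 h : R -> R, mu.-integrable I01 (EFin \o h) &
    forall r, 0 < r < 1 -> ((f r / r) ^+ 2 + derive1 f r ^+ 2) * r <= h r) ->
  (k = 0%N -> forall d : R, 0 < d ->
    \forall r \near (0 : R)^'+, `|f r| <= d * `|ln r|) ->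
  exists c, forall r, 0 < r < 1 -> f r = c * v r /\ derive1 f r = c * v1 r.
Proof.
move=> fA f1A ode kpos k0.
have f1c (r : R) : 0 < r < 1 -> {for r, continuous (derive1 f)}.
  by move=> r01; exact: AC_loc_continuous.
have fd (r : R) : 0 < r < 1 -> is_derive r 1 f (derive1 f r).
  by move=> r01; exact: AC_loc_is_derive1.
pose f2 r := - (r^-1 * derive1 f r) + (V r - x) * f r.
have f2c (r : R) : 0 < r < 1 -> {for r, continuous f2}.
  move=> r01; have /andP[r0 _] := r01.
  have fc : {for r, continuous f} := is_derive_continuous (fd r r01).
  have ic : {for r, continuous (fun r : R => r^-1)} by apply: inv_continuous; rewrite gt_eqF.
  have Vc : {for r, continuous V}.
    have q1 : {for r, continuous (fun r : R => m%:~R / r - b * r / 2)}.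
      apply: continuousB; first by apply: continuousM; [exact: cst_continuous|exact: ic].
      apply: continuousM; last exact: cst_continuous.
      by apply: continuousM; [exact: cst_continuous|exact: cvg_id].
    exact: (continuousM q1 q1).
  have p1 := continuousN (continuousM ic (f1c r r01)).
  have p2 := continuousM (continuousB Vc (@cst_continuous _ _ x _)) fc.
  exact: (continuousD p1 p2).
have f1d (r : R) : 0 < r < 1 -> is_derive r 1 (derive1 f) (f2 r).
  move=> r01; apply: AC_loc_is_derive => //.
  move: ode; apply: filterS; first exact: (ae_filter_ringOfSetsType mu).
  by move=> u h /h; rewrite /f2; lra.
have ode' (r : R) : 0 < r < 1 -> - f2 r - r^-1 * derive1 f r + (m%:~R / r - b * r / 2) ^+ 2 * f r = x * f r.
  by move=> _; rewrite /f2 /V; ring.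
apply: (eigenfunction_multiple b0 mk fd f1d ode').
have [k0'|kp] := posnP k; last first.
  have [h hi fh] := kpos kp.
  exact: (wronskian0_integrable b0 mk fd f1d ode' kp hi fh).
exact: (wronskian0_ln b0 mk fd f1d ode' k0' (k0 k0')).
Qed.

Lemma eigenspace_multiple (u : R -> R[i]) : Defs.eigenspace m b x u ->
  exists c : R[i], (forall r, 0 < r < 1 -> u r = c * uC r) /\
    (c != 0 -> neumann_fun a k (b / 2) = 0).
Proof.
move=> [[[[fA gA] [f1A g1A]] uL2 _ neu bc] ode].
pose f r := complex.Re (u r); pose g r := complex.Im (u r).
have {}f1A : AC_loc (derive1 f) by exact: f1A.
have {}g1A : AC_loc (derive1 g) by exact: g1A.
have opRe r : complex.Re (opH m b u r) = - derive1 (derive1 f) r - r^-1 * derive1 f r + V r * f r.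
  by rewrite /opH !ReD !ReN !Re_realM.
have opIm r : complex.Im (opH m b u r) = - derive1 (derive1 g) r - r^-1 * derive1 g r + V r * g r.
  by rewrite /opH !ImD !ImN !Im_realM.
have odef : {ae mu, forall r, I01 r ->
    - derive1 (derive1 f) r - r^-1 * derive1 f r + V r * f r = x * f r}.
  move: ode; apply: filterS; first exact: (ae_filter_ringOfSetsType mu).
  by move=> r h /h /(congr1 (@complex.Re R)); rewrite opRe Re_realM.
have odeg : {ae mu, forall r, I01 r ->
    - derive1 (derive1 g) r - r^-1 * derive1 g r + V r * g r = x * g r}.
  move: ode; apply: filterS; first exact: (ae_filter_ringOfSetsType mu).
  by move=> r h /h /(congr1 (@complex.Im R)); rewrite opIm Im_realM.
have bound : (0 < k)%N -> exists2 h : R -> R, mu.-integrable I01 (EFin \o h) &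
    forall r, 0 < r < 1 -> ((f r / r) ^+ 2 + derive1 f r ^+ 2) * r <= h r /\
      ((g r / r) ^+ 2 + derive1 g r ^+ 2) * r <= h r.
  rewrite lt0n -m0k => m0; move: bc; rewrite m0 => -[[_ _ i1] [_ _ i2]].
  exists (fun r => Normc.normc (u r / r%:C) ^+ 2 * r + Normc.normc (cderiv u r) ^+ 2 * r).
    by apply: eq_integrable (integrableD _ i1 i2) => // r _; rewrite EFinD.
  move=> r /andP[r0 _]; rewrite !normc_sqr realC_inv [u r * _]mulrC Re_realM Im_realM /= -/(f r) -/(g r).
  rewrite -mulrDl ![r^-1 * _]mulrC.
  by split; apply: ler_wpM2r; rewrite ?(ltW r0)// lerD// ?lerDl ?lerDr sqr_ge0.
have near0 : k = 0%N -> forall d : R, 0 < d -> \forall r \near (0 : R)^'+,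
    `|f r| <= d * `|ln r| /\ `|g r| <= d * `|ln r|.
  move=> k0 d d0; move: bc; rewrite m0k k0 eqxx /= => /cvgrPdist_le /(_ d d0) h.
  near=> r.
  have r0 : 0 < r by near: r; exact: nbhs_right_gt.
  have r1 : r < 1 by near: r; exact: nbhs_right_lt.
  have ln0 : ln r < 0 by rewrite ln_lt0// r0.
  have ln1 : 0 < `|ln r| by rewrite normr_gt0 lt_eqF.
  have hr : `|0 - Normc.normc (u r / (ln r)%:C)| <= d by near: r; exact: h.
  rewrite sub0r normrN in hr.
  have {}hr := le_trans (ler_norm _) hr.
  have hf := le_trans (Re_le_normc _) hr; have hg := le_trans (Im_le_normc _) hr.
  move: hf hg; rewrite realC_inv [u r * _]mulrC Re_realM Im_realM -/(f r) -/(g r).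
  by rewrite !normrM normfV ![_^-1 * _]mulrC !ler_pdivrMr.
have [c1 c1P] : exists c, forall r, 0 < r < 1 -> f r = c * v r /\ derive1 f r = c * v1 r.
  apply: (real_eigenfunction fA f1A odef).
    by move=> /bound [h hi hP]; exists h => // r /hP[].
  by move=> /near0 h d /h; apply: filterS => r [].
have [c2 c2P] : exists c, forall r, 0 < r < 1 -> g r = c * v r /\ derive1 g r = c * v1 r.
  apply: (real_eigenfunction gA g1A odeg).
    by move=> /bound [h hi hP]; exists h => // r /hP[].
  by move=> /near0 h d /h; apply: filterS => r [].
(* The Neumann condition is a limit of |u'| at 1, while v' is continuous up to 1, so the bound
   passes to the limit. *)
have v1lim (c : R) : (forall r, 0 < r < 1 -> `|c * v1 r| <= Normc.normc (cderiv u r)) -> c * v1 1 = 0.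
  move=> h; apply/eqP; rewrite -normr_eq0; apply/eqP.
  have cv : `|c * v1 r| @[r --> (1 : R)^'-] --> `|c * v1 1|.
    apply: cvg_norm; apply: cvgM; first exact: cvg_cst.
    by apply: cvg_at_left_filter; exact: continuous_regsol'.
  apply/eqP; rewrite -normr_le0 normr_id -(cvg_lim _ neu)// -(cvg_lim _ cv)//.
  apply: ler_lim; [by apply/cvg_ex; eexists; exact: cv|by apply/cvg_ex; eexists; exact: neu|].
  near=> r; apply: h; apply/andP; split; near: r; [exact: nbhs_left_gt|exact: nbhs_left_lt].
exists (c1 +i* c2); split.
  move=> r r01; have [fE _] := c1P _ r01; have [gE _] := c2P _ r01.
  rewrite /uC; apply/eqP; rewrite eq_complex [_ * (v r)%:C]mulrC Re_realM Im_realM /=.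
  by rewrite ![v r * _]mulrC -fE -gE !eqxx.
move=> c0; have e1 : c1 * v1 1 = 0.
  apply: v1lim => r r01; have [_ <-] := c1P _ r01; exact: (Re_le_normc (cderiv u r)).
have e2 : c2 * v1 1 = 0.
  apply: v1lim => r r01; have [_ <-] := c2P _ r01; exact: (Im_le_normc (cderiv u r)).
have v10 : v1 1 = 0.
  apply/eqP; apply: contraNT c0 => v10.
  by move/eqP: e1; move/eqP: e2; rewrite !mulf_eq0 (negbTE v10) !orbF => /eqP -> /eqP ->.
move: v10; rewrite /v1 regsol'1 => /eqP; rewrite mulf_eq0 gt_eqF ?expR_gt0//=.
by move/eqP.
Unshelve. all: by end_near. Qed.

Let regsol_mul_inj (c c' : R[i]) :
  eqL2 (fun r => c * uC r) (fun r => c' * uC r) -> c = c'.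
Proof.
move=> cc; have [e [e0 e1 vP]] := regsol_near0 a b k.
have [r [r0 re h]] := ae_exists e0 (ltW e1) cc.
apply: (mulIf _ h); rewrite /uC (_ : 0 = 0%:C)// (inj_eq (@complexI R)).
have /andP[vr _] := vP _ r0 (ltW re).
by rewrite gt_eqF// (lt_le_trans _ vr)// mulr_gt0 ?invr_gt0// exprn_gt0.
Qed.

Let eqL2I01 (u w : R -> R[i]) : (forall r, 0 < r < 1 -> u r = w r) -> eqL2 u w.
Proof. by move=> uw; apply: aeW => r; rewrite /= in_itv/=; exact: uw. Qed.

Lemma multiplicity_neumann :
  multiplicity m b x (neumann_fun a k (b / 2) == 0 : nat).
Proof.
have [n0|n0] := eqVneq (neumann_fun a k (b / 2)) 0.
  exists (fun=> uC); split; first by move=> _; exact: eigenspace_regsol.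
  move=> u uE; have [c [uc _]] := eigenspace_multiple uE.
  exists (\row_(i < 1) c); split.
    by apply: eqL2I01 => r r01; rewrite big_ord1 mxE uc.
  move=> c' c'E; apply/rowP => i; rewrite mxE ord1; apply: regsol_mul_inj.
  move: c'E; apply: filterS; first exact: (ae_filter_ringOfSetsType mu).
  move=> r h I; rewrite -uc; last by move: I; rewrite /= in_itv.
  by rewrite h// big_ord1.
exists (fun=> uC); split; first by case.
move=> u uE; have [c [uc c0]] := eigenspace_multiple uE.
have {}c0 : c = 0 by apply/eqP; apply: contraNT n0 => /c0 ->.
exists 0; split.
  by apply: eqL2I01 => r r01; rewrite big_ord0 uc// c0 mul0r.
by move=> c' _; apply/rowP => -[].
Qed.

(** Basis vectors are multiples c_i of the regular solution with c_i nonzero. Two of them would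
    satisfy c_1 e_0 - c_0 e_1 = 0, against uniqueness of coordinates. The dimension must be
    determined for every admissible basis because [lambdaN] quantifies over all of them. *)
Lemma multiplicity_unique d : multiplicity m b x d ->
  d = (neumann_fun a k (b / 2) == 0).
Proof.
move=> [e [eE eP]].
have [c cP] := choice (fun i => eigenspace_multiple (eE i)).
have eqL2_repr (i : 'I_d) (c1 c2 : 'rV[R[i]]_d) :
    (forall r, 0 < r < 1 -> \sum_(j < d) c1 0 j * e j r = e i r) ->
    (forall r, 0 < r < 1 -> \sum_(j < d) c2 0 j * e j r = e i r) -> c1 = c2.
  move=> h1 h2; have [c' [_ c'U]] := eP _ (eE i).
  rewrite -(c'U c1); last by apply: eqL2I01 => r /h1.
  by apply: c'U; apply: eqL2I01 => r /h2.
have delta i r : \sum_(j < d) (delta_mx 0 i : 'rV[R[i]]_d) 0 j * e j r = e i r.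
  rewrite (bigD1 i)//= big1 ?addr0 => [|j ji]; first by rewrite mxE !eqxx mul1r.
  by rewrite mxE eqxx (negbTE ji) mul0r.
have cn0 i : c i != 0.
  apply/negP => /eqP ci0.
  have : delta_mx 0 i = 0 :> 'rV[R[i]]_d.
    apply: (eqL2_repr i) => r r01; first exact: delta.
    rewrite big1 => [|j _]; last by rewrite mxE mul0r.
    by have [-> // _] := cP i; rewrite ci0 mul0r.
  by move/rowP/(_ i); rewrite !mxE !eqxx => /eqP; rewrite oner_eq0.
have dle1 : (d <= 1)%N.
  rewrite leqNgt; apply/negP => d1.
  pose i0 := Ordinal (ltnW d1); pose i1 := Ordinal d1.
  have i01 : i0 != i1 by [].
  pose c2 : 'rV[R[i]]_d := delta_mx 0 i0 + (c i1 *: delta_mx 0 i0 + (- c i0) *: delta_mx 0 i1).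
  have c2E : delta_mx 0 i0 = c2.
    apply: (eqL2_repr i0) => r r01; first exact: delta.
    rewrite (eq_bigr (fun j => (delta_mx 0 i0 : 'rV[R[i]]_d) 0 j * e j r
      + (c i1 * ((delta_mx 0 i0 : 'rV[R[i]]_d) 0 j * e j r)
         + (- c i0) * ((delta_mx 0 i1 : 'rV[R[i]]_d) 0 j * e j r)))); last first.
      by move=> j _; rewrite /c2; move: (delta_mx 0 i0) (delta_mx 0 i1) => A B; rewrite !mxE; ring.
    rewrite !big_split/= -!mulr_sumr !delta.
    have [-> // _] := cP i0; have [-> // _] := cP i1.
    by ring.
  have := congr1 (fun w : 'rV_d => w 0 i1) c2E.
  rewrite !mxE !eqxx eq_sym (negbTE i01) /= mulr0 !add0r mulr1 => /esym/eqP.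
  by rewrite oppr_eq0 (negbTE (cn0 i0)).
have [n0|n0] := eqVneq (neumann_fun a k (b / 2)) 0.
  apply/eqP; rewrite eqn_leq dle1 /= lt0n; apply/eqP => d0.
  subst d.
  have [c' [h _]] := eP _ (eigenspace_regsol n0).
  have : (1 : R[i]) = 0.
    apply: regsol_mul_inj; move: h; apply: filterS; first exact: (ae_filter_ringOfSetsType mu).
    by move=> r h /h; rewrite big_ord0 mul1r mul0r.
  by move/eqP; rewrite oner_eq0.
case: d e eE eP c cP eqL2_repr delta cn0 dle1 => // d e eE eP c cP _ _ cn0 _.
have [_ h] := cP ord0; move: n0.
by rewrite (h (cn0 ord0)) eqxx.
Qed.

End Eigenspace.

(** * Enumeration of the eigenvalues *)

Section Counting.
Variable R : realType.
Variables (m : int) (b : R) (n : nat) (N : R -> bool) (ls : nat -> R).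
Hypothesis mulN : forall x, multiplicity m b x (N x).
Hypothesis mulU : forall x d, multiplicity m b x d -> d = N x.
Hypothesis ls_lt : forall p q, (p < q)%N -> ls p < ls q.
Hypothesis Nls : forall p, (p <= n)%N -> N (ls p).
Hypothesis lsN : forall x, N x -> x <= ls n -> exists2 p, (p <= n)%N & x = ls p.

Let ls_mono : {mono ls : p q / (p <= q)%N >-> p <= q}.
Proof.
by apply: le_mono => p q; rewrite ltEnat; exact: ls_lt.
Qed.

Let s := mkseq ls n.+1.

Let last_s : last 0 s = ls n.
Proof. by rewrite -nth_last size_mkseq nth_mkseq. Qed.

Let mem_s x : x <= ls n -> (x \in s) = N x.
Proof.
move=> xn; apply/idP/idP => [/mapP[p]|Nx].
  by rewrite mem_iota add0n => pn ->; exact: Nls.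
have [p pn ->] := lsN Nx xn.
by apply/mapP; exists p => //; rewrite mem_iota.
Qed.

Let uniq_s : uniq s.
Proof.
rewrite map_inj_uniq ?iota_uniq// => p q pq.
by apply/eqP; rewrite eqn_leq -!ls_mono pq lexx.
Qed.

Lemma first_eigenvalues_mkseq : first_eigenvalues m b n.+1 s.
Proof.
split; first exact: size_mkseq.
- apply: (@homo_sorted _ _ ls leq <=%R); last exact: iota_sorted.
  by move=> p q pq; rewrite ls_mono.
- move=> x; rewrite last_s => /ltW xn.
  by rewrite count_uniq_mem// mem_s//; exact: mulN.
exists (N (ls n)); first by rewrite last_s; exact: mulN.
by rewrite last_s count_uniq_mem// mem_s.
Qed.

(** The value chosen by [xget] must be shown unique. A competing list has distinct entries and
    contains every eigenvalue below its last one. If it ended below [ls n] it would fit into the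
    first n levels, too few; if it ended above, it would contain all n + 1 levels and its own last
    entry, too many. *)
Lemma lambdaN_eq : lambdaN m b n.+1 = ls n.
Proof.
apply: xget_unique; first by exists s => //; exact: first_eigenvalues_mkseq.
move=> l' [s' [szs' ss' mlt [d md dle]] l'E]; rewrite l'E in mlt md dle.
have s'0 : (0 < size s')%N by rewrite szs'.
have s'l x : x \in s' -> x <= l'.
  move=> xs; rewrite -l'E -nth_last -(nth_index 0 xs).
  apply: (sorted_leq_nth le_trans le_refl 0 ss'); rewrite ?inE ?index_mem ?prednK//.
  by rewrite -ltnS prednK// index_mem.
have cnt x : x < l' -> count_mem x s' = N x by move=> /mlt /mulU.
have Nl' : (count_mem l' s' <= N l')%N by rewrite -(mulU md).
have cle x : (count_mem x s' <= N x)%N.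
  have [xl|xl|->] := ltgtP x l'; [by rewrite cnt| |exact: Nl'].
  rewrite (count_memPn _)//; apply/negP => /s'l; by rewrite leNgt xl.
have N_s' x : x \in s' -> N x.
  by rewrite -has_pred1 has_count => h; have := leq_trans h (cle x); case: (N x).
have us' : uniq s'.
  apply: count_mem_uniq => x; apply/eqP; rewrite eqn_leq; apply/andP; split.
    have [xs|xs] := boolP (x \in s'); first by rewrite (leq_trans (cle x))// leq_b1.
    by rewrite (count_memPn xs).
  have [xs|//] := boolP (x \in s').
  by rewrite -has_count has_pred1.
have l's : l' \in s' by rewrite -l'E -nth_last mem_nth// prednK.
have [ll|ll|//] := ltgtP l' (ls n).
  have : (size s' <= size (mkseq ls n))%N.
    apply: uniq_leq_size => // x xs'; have xl := le_lt_trans (s'l _ xs') ll.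
    have [p pn xE] := lsN (N_s' _ xs') (ltW xl).
    rewrite xE; apply/mapP; exists p => //; rewrite mem_iota add0n /=.
    by rewrite ltn_neqAle pn andbT; apply: contraTneq xl => pnE; rewrite xE pnE ltxx.
  by rewrite szs' size_mkseq ltnn.
have : (size (l' :: s) <= size s')%N.
  apply: uniq_leq_size.
    rewrite cons_uniq uniq_s andbT; apply/negP => /mapP[p]; rewrite mem_iota add0n => pn l'p.
    by move: ll; rewrite l'p ltNge ls_mono -ltnS; case/andP: pn => _ ->.
  move=> x; rewrite inE => /orP[/eqP ->//|xs].
  have xn : x <= ls n by move/mapP: xs => [p]; rewrite mem_iota add0n => /andP[_ pn] ->; rewrite ls_mono.
  have : count_mem x s' = 1%N by rewrite cnt ?(le_lt_trans xn)// -mem_s// xs.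
  by rewrite -has_pred1 has_count => ->.
have -> : size (l' :: s) = n.+2 by rewrite /= size_map size_iota.
by rewrite szs' ltnn.
Qed.

End Counting.

(** * The n-th eigenvalue and its expansion *)

Section Asymptotics.
Variable R : realType.

(** Eigenvalues are ordered by p - x, so the bound 1/4 keeps the levels of successive p in strict
    order. *)
Lemma root_small p k : \forall z \near +oo, forall x : R,
  root_range p x -> neumann_fun (x - p%:R) k z = 0 -> `|x| <= 4^-1.
Proof.
have [K [K0 KP]] := root_crude R p k.
near=> z => x xr x0.
have h : `|x| * expR z <= K * z ^+ (2 * p + k + 4).
  by move: x xr x0; near: z; exact: KP.
have h2 : 4 * K * z ^+ (2 * p + k + 4) <= expR z by near: z; exact: pow_le_expR.
by rewrite -(ler_pM2r (expR_gt0 z)) (le_trans h)//; lra.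
Unshelve. all: by end_near. Qed.

Lemma root_range_exists (a : R) : a <= 1 ->
  exists p, exists2 y, root_range p y & a = y - p%:R.
Proof.
move=> a1; have [ah|ah] := leP a 2^-1; last first.
  by exists 0%N, a; [split => //=; lra|rewrite subr0].
have h0 : 0 <= 2^-1 - a by lra.
have /andP[h1 h2] := truncn_itv h0.
exists (Num.truncn (2^-1 - a)), (a + (Num.truncn (2^-1 - a))%:R); last by ring.
move: h1 h2; move: (Num.truncn _) => p h1; rewrite -[p.+1%:R]natr1 => h2.
by split; [lra|case: ifP => _; lra].
Qed.

Variables (n : nat) (m : int).
Let k := `|m|%N.

(** The relation between the eigenvalue and Kummer's parameter, solved for the eigenvalue at
    parameter y - p. *)
Definition level (b : R) (p : nat) (y : R) : R :=
  2 * b * (p%:R - y + 2^-1 + (k%:R - m%:~R) / 2).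

Lemma kummer_param_level b p y : 0 < b -> kummer_param m b (level b p y) = y - p%:R.
Proof. by move=> b0; rewrite /kummer_param /level; field; rewrite gt_eqF. Qed.

Lemma level_kummer_param b x p y : 0 < b -> kummer_param m b x = y - p%:R ->
  x = level b p y.
Proof.
move=> b0; rewrite /kummer_param /level -/k => h.
have -> : p%:R - y = - (2^-1 + (k%:R - m%:~R) / 2 - x / (2 * b)) by rewrite h; ring.
by field; rewrite gt_eqF.
Qed.

(** Thresholds for z depend on p, so only the finitely many p <= n are controlled. A root with p > n
    has y <= 1/2, hence p - y >= n + 1/2, and its eigenvalue lies above the level of n, where p - y
    is at most n + 1/4. *)
Lemma lambdaN_level : \forall z \near +oo, exists y : R,
  [/\ root_range n y, neumann_fun (y - n%:R) k z = 0 &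
      lambdaN m (2 * z) n.+1 = level (2 * z) n y].
Proof.
have ex : \forall z \near +oo, forall p : 'I_n.+1,
    exists x : R, root_range p x /\ neumann_fun (x - p%:R) k z = 0.
  by apply: filter_forall => p; exact: root_exists.
have un : \forall z \near +oo, forall p : 'I_n.+1, forall x y : R,
    root_range p x -> root_range p y ->
    neumann_fun (x - p%:R) k z = 0 -> neumann_fun (y - p%:R) k z = 0 -> x = y.
  by apply: filter_forall => p; exact: root_unique.
have sm : \forall z \near +oo, forall p : 'I_n.+1, forall x : R,
    root_range p x -> neumann_fun (x - p%:R) k z = 0 -> `|x| <= 4^-1.
  by apply: filter_forall => p; exact: root_small.
near=> z.
have z0 : 0 < z by near: z; exact: nbhs_pinfty_gt.
have exz : forall p : 'I_n.+1, exists x : R, root_range p x /\ neumann_fun (x - p%:R) k z = 0.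
  by near: z; exact: ex.
have unz : forall p : 'I_n.+1, forall x y : R, root_range p x -> root_range p y ->
    neumann_fun (x - p%:R) k z = 0 -> neumann_fun (y - p%:R) k z = 0 -> x = y.
  by near: z; exact: un.
have smz : forall p : 'I_n.+1, forall x : R,
    root_range p x -> neumann_fun (x - p%:R) k z = 0 -> `|x| <= 4^-1.
  by near: z; exact: sm.
have b0 : 0 < 2 * z by rewrite mulr_gt0.
have b20 : 0 < 2 * (2 * z) by rewrite mulr_gt0.
have bz : 2 * z / 2 = z by field.
have ex' p : exists x, `|x| <= 4^-1 /\
    ((p <= n)%N -> root_range p x /\ neumann_fun (x - p%:R) k z = 0).
  have [pn|pn] := leqP p n; last first.
    (* Beyond n the value 0 only makes the sequence of levels total and strictly increasing. *)
    by exists 0; split => //; rewrite normr0 invr_ge0.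
  by have [x [xr x0]] := exz (Ordinal (pn : (p < n.+1)%N)); exists x; split => //; exact: (smz (Ordinal (pn : (p < n.+1)%N))).
have [xs xsP] := choice ex'.
have [_ /(_ (leqnn n)) [xr x0]] := xsP n.
exists (xs n); split => //.
pose N x := neumann_fun (kummer_param m (2 * z) x) k z == 0.
pose ls p := level (2 * z) p (xs p).
have h4 p : - 4^-1 <= xs p <= 4^-1 by rewrite -ler_norml; have [] := xsP p.
apply: (@lambdaN_eq _ _ _ _ N ls).
- by move=> x; have := multiplicity_neumann m x b0; rewrite bz.
- by move=> x d /(multiplicity_unique b0); rewrite bz.
- move=> p q pq; rewrite /ls /level ltr_pM2l//.
  have : p%:R + 1 <= q%:R :> R by rewrite natr1 ler_nat.
  by have /andP[? ?] := h4 p; have /andP[? ?] := h4 q; lra.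
- by move=> p pn; rewrite /N /ls kummer_param_level//; have [_ /(_ pn)[_ ->]] := xsP p.
move=> x /eqP Nx xn.
have a1 : kummer_param m (2 * z) x <= 1.
  by rewrite leNgt; apply/negP => /ltW a1; have := neumann_fun_gt0 k a1 z0; rewrite Nx ltxx.
have [p [y yr ay]] := root_range_exists a1.
have xE := level_kummer_param b0 ay.
have pn : (p <= n)%N.
  move: xn; rewrite xE /ls /level ler_pM2l// => h.
  have [_] := yr; case: eqP => [-> //|_] y2; rewrite -ltnS -(ltr_nat R) -natr1.
  by have /andP[? ?] := h4 n; lra.
exists p => //; rewrite xE /ls; congr level.
have [_ /(_ pn)[xsr xs0]] := xsP p.
by apply: (unz (Ordinal (pn : (p < n.+1)%N))) => //=; rewrite -ay.
Unshelve. all: by end_near. Qed.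

End Asymptotics.

Unset Implicit Arguments.

Theorem theorem1 (R : realType) (n : nat) (m : int) (hn : (1 <= n)%N) :
  exists K b0 : R, 0 < K /\ 0 < b0 /\
    forall b : R, b0 <= b ->
      exists E : R,
        `|E| <= K * b ^+ (2 * n + `|m| - 1)%N /\
        lambdaN m b n =
          ((2 * n)%:Z - 1 + `|m|%:Z - m)%:~R * b
          - expR (- (b / 2)) *
            (b ^+ (2 * n + `|m|)%N /
               ((n - 1)`!%:R * (`|m| + n - 1)`!%:R
                * 2 ^+ (2 * (n - 1) + `|m|)%N)
             + E).
Proof.
case: n hn => // p _.
set k := `|m|%N.
have [C CP] := root_asympt R p k.
have [M [_ MP]] : \forall z \near +oo, exists y : R,
    `|y - z ^+ (2 * p + k).+1 / (p`!%:R * (k + p)`!%:R) * expR (- z)|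
      <= C * z ^+ (2 * p + k) * expR (- z) /\ lambdaN m (2 * z) p.+1 = level m (2 * z) p y.
  near=> z.
  have [y [yr y0 lE]] : exists y : R, [/\ root_range p y, neumann_fun (y - p%:R) k z = 0 &
      lambdaN m (2 * z) p.+1 = level m (2 * z) p y] by near: z; exact: lambdaN_level.
  exists y; split => //; move: y yr y0 {lE}; near: z; exact: CP.
(* The factor 2 is that of 2 b in [level], the added 1 makes the constant positive, and the
   threshold ensures b / 2 > M. *)
exists (2 * `|C| + 1), (2 * (`|M| + 1)); split; first by rewrite ltr_wpDl// mulr_ge0.
split; first by rewrite mulr_gt0// ltr_wpDl.
move=> b bM; pose z := b / 2.
have Mz : M < z.
  by rewrite /z; have := ler_norm M; lra.
have b0 : 0 < b by have := normr_ge0 M; lra.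
have [y [yC lE]] := MP z Mz.
have bE : 2 * z = b by rewrite /z; field.
pose main := b ^+ (2 * p + k).+2 / (p`!%:R * (k + p)`!%:R * 2 ^+ (2 * p + k)).
have e1 : (2 * p.+1 + k = (2 * p + k).+2)%N by lia.
have e2 : (p.+1 - 1 = p)%N by lia.
have e3 : (k + p.+1 - 1 = k + p)%N by lia.
have e4 : (2 * p.+1 + k - 1 = (2 * p + k).+1)%N by lia.
rewrite e4 e1 e2 e3 -/main -/z.
have zb n : z ^+ n <= b ^+ n.
  by rewrite lerXn2r ?nnegrE /z ?divr_ge0 ?(ltW b0)//; lra.
rewrite bE in lE.
(* E is the value that the formula forces. Since 2 b z^{2p+k+1} = b^{2p+k+2} / 2^{2p+k}, [main] is
   exactly the leading term of e^z 2 b y. *)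
exists (expR z * (2 * b * y) - main); split; last first.
  rewrite [main + _]addrC subrK mulrA -expRD addNr expR0 mul1r lE /level -/k.
  have -> : ((2 * p.+1)%:Z - 1 + k%:Z - m)%:~R = 2 * (p%:R + 1) - 1 + k%:R - m%:~R :> R.
    by rewrite rmorphB rmorphD rmorphB /= -!pmulrn natrM natr1.
  by field.
have -> : expR z * (2 * b * y) - main = 2 * b * expR z *
    (y - z ^+ (2 * p + k).+1 / (p`!%:R * (k + p)`!%:R) * expR (- z)).
  rewrite expRN /main /z exprMn exprVn !exprS.
  by field; rewrite !factr_neq0 gt_eqF ?expR_gt0//=.
rewrite normrM ger0_norm; last by rewrite !mulr_ge0 ?expR_ge0 ?ltW.
apply: (@le_trans _ _ (2 * b * expR z * (`|C| * z ^+ (2 * p + k) * expR (- z)))).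
  rewrite ler_wpM2l ?mulr_ge0 ?expR_ge0 ?(ltW b0)// (le_trans yC)//.
  rewrite ler_wpM2r ?expR_ge0// ler_wpM2r ?ler_norm// exprn_ge0// /z divr_ge0// ltW//.
rewrite expRN [leLHS](_ : _ = 2 * `|C| * (b * z ^+ (2 * p + k))); last first.
  by field; rewrite gt_eqF ?expR_gt0.
apply: (@le_trans _ _ (2 * `|C| * (b * b ^+ (2 * p + k)))).
  by rewrite ler_wpM2l ?mulr_ge0// ler_wpM2l ?(ltW b0).
by rewrite -exprS ler_wpM2r ?lerDl// exprn_ge0// ltW.
Unshelve. all: by end_near. Qed.
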